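(* Let $M$ be a closed connected smooth Riemannian manifold, and let $\mathcal{M}$ be the space of all smooth Riemannian metrics on $M$. Then $\mathcal{M}$ has the structure of a bounded Fréchet manifold. Furthermore, $\mathcal{M}$ is an $MC^{\infty}$-Fréchet manifold.
   Context: Closed means compact without boundary. $\mathcal{M}$ is the set of smooth sections of the bundle of symmetric $(0,2)$-tensors on $M$ that are positive definite at every point. Standard metrics. The topology of every Fréchet space is taken to be defined by a complete translation-invariant metric with absolutely convex balls (a standard metric); every Fréchet space admits one. The groups $\mathcal{L}_{g,d}(E,F)$. For Fréchet spaces $(E,g)$ and $(F,d)$, let $\mathcal{L}_{g,d}(E,F)$ be the set of all linear maps $L:E\to F$ such that $$\mathrm{Lip}(L)_{g,d}:=\sup_{x\in E\setminus\{0\}}\frac{d(L(x),0)}{g(x,0)}<\infty ,$$ equipped with the translation-invariant metric $D_{g,d}(L,H)=\mathrm{Lip}(L-H)_{g,d}$, which makes it an Abelian topological group. Let $\mathcal{L}_{g,d}(E,F)_0$ be the connected component of the zero map; with the metric $D_{g,d}$ it is regarded as a Fréchet space. Keller-differentiability. Let $U\subseteq E$ be open and $P:U\to F$ continuous. $P$ is differentiable at $p\in U$ if the directional derivative $\mathrm{d}P(p)h$ exists for all $h\in E$. $P$ is Keller-differentiable if it is differentiable at all points of $U$, the map $\mathrm{d}P:U\to CL(E,F)$ is continuous, where $CL(E,F)$ is the space of continuous linear maps with the compact-open topology, and the map $P':U\times E\to F$, $(u,h)\mapsto \mathrm{d}P(u)h$, is continuous in the product topology. $MC^k$-maps. $P$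 is bounded differentiable if it is Keller-differentiable, $\mathrm{d}P(p)\in\mathcal{L}_{g,d}(E,F)$ for all $p\in U$, and the map $\mathrm{d}P:U\to\mathcal{L}_{g,d}(E,F)$ is continuous. $P$ is $MC^0$ if it is continuous, and $MC^1$ if it is bounded differentiable. For $k\ge 2$, $P$ is $MC^k$ if it is $MC^1$ and each $x_0\in U$ has a connected open neighborhood $V\subseteq U$ such that the map $\mathrm{d}P|_V-\mathrm{d}P(x_0):V\to\mathcal{L}_{g,d}(E,F)_0$ is $MC^{k-1}$. $P$ is $MC^\infty$ if it is $MC^k$ for all $k\in\mathbb{N}_0$. $MC^k$-Fréchet manifolds. An $MC^k$-Fréchet manifold ($k\in\mathbb{N}\cup\{\infty\}$), also called a bounded Fréchet manifold, is defined in the usual way: a Hausdorff space with an atlas of charts that are homeomorphisms onto open subsets of Fréchet spaces (with fixed standard metrics), all of whose coordinate transition functions are $MC^k$-maps. *)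

(* Defs.v *)
From HB Require Import structures.
From mathcomp Require Import all_boot all_order all_algebra.
From mathcomp Require Import all_classical all_reals all_analysis.

Set Implicit Arguments.
Unset Strict Implicit.
Unset Printing Implicit Defensive.

Import Order.TTheory GRing.Theory Num.Theory.
Import numFieldNormedType.Exports.

Local Open Scope classical_set_scope.
Local Open Scope ring_scope.

Definition absolutely_convex (R : realType) (E : lmodType R) (A : set E) :=
  forall (a b : R) x y, `|a| + `|b| <= 1 -> A x -> A y -> A (a *: x + b *: y).

(* A Frechet space with a fixed standard metric. Local convexity is implied by
   [fball_convex] and [fnbhsE]; balls centered elsewhere are translates. *)
Record frechet (R : realType) := Frechet {
  fspace :> topologicalLmodType R;
  fdist : fspace -> fspace -> R;
  fdistxx : forall x, fdist x x = 0;
  fdist_eq : forall x y, fdist x y = 0 -> x = y;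
  fdist_sym : forall x y, fdist x y = fdist y x;
  fdist_triangle : forall y x z, fdist x z <= fdist x y + fdist y z;
  fdistD2r : forall z x y, fdist (x + z) (y + z) = fdist x y;
  fball_convex : forall r : R, absolutely_convex [set x | fdist x 0 < r];
  fnbhsE : forall x : fspace, nbhs x =
    filter_from [set e : R | 0 < e] (fun e => [set y | fdist x y < e]);
  fcomplete : forall u : nat -> fspace,
    (forall e : R, 0 < e -> exists N, forall m n,
       (N <= m)%N -> (N <= n)%N -> fdist (u m) (u n) < e) ->
    exists l : fspace, u @ \oo --> l
}.

Section FrechetTheory.
Context {R : realType} (E : frechet R).
Implicit Types x y : E.

Lemma fdist_ge0 x y : 0 <= fdist x y.
Proof.
by rewrite -(@pmulrn_lge0 _ _ 2)// -(fdistxx x) (le_trans (fdist_triangle y _ _))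
  // (fdist_sym y) mulr2n.
Qed.

Lemma fdist_gt0 x y : (0 < fdist x y) = (x != y).
Proof.
rewrite lt_neqAle fdist_ge0 andbT eq_sym; congr (~~ _).
by apply/eqP/eqP => [/fdist_eq//|->]; rewrite fdistxx.
Qed.

Lemma fdistB x y : fdist x y = fdist (x - y) 0.
Proof. by rewrite -(fdistD2r (- y)) subrr. Qed.

Lemma fdistD x y : fdist (x + y) 0 <= fdist x 0 + fdist y 0.
Proof.
rewrite (le_trans (fdist_triangle y _ _))// lerD2r.
by rewrite -[X in fdist _ X]add0r fdistD2r.
Qed.

Lemma fdistN x : fdist (- x) 0 = fdist x 0.
Proof. by rewrite fdist_sym fdistB opprK add0r. Qed.

Lemma fdist_conv (a b : R) x y : `|a| + `|b| <= 1 ->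
  fdist (a *: x + b *: y) 0 <= Num.max (fdist x 0) (fdist y 0).
Proof.
move=> ab; apply/ler_addgt0Pl => e e0; apply: ltW.
by apply: fball_convex => //=; rewrite ltr_pwDl// le_max lexx ?orbT.
Qed.

Lemma fdistZ1 (t : R) x : `|t| <= 1 -> fdist (t *: x) 0 <= fdist x 0.
Proof.
by have := @fdist_conv t 0 x x; rewrite scale0r maxxx normr0 !addr0.
Qed.

Lemma fdistZn (n : nat) (t : R) x : `|t| <= n%:R ->
  fdist (t *: x) 0 <= n%:R * fdist x 0.
Proof.
have H m : fdist (m%:R *: x) 0 <= m%:R * fdist x 0.
  elim: m => [|m IH]; first by rewrite scale0r mul0r fdistxx.
  rewrite -natr1 scalerDl mulrDl scale1r mul1r.
  by rewrite (le_trans (fdistD _ _))// lerD2r.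
case: n => [|n] tn.
  by move: tn; rewrite normr_le0 => /eqP ->; rewrite scale0r mul0r fdistxx.
have -> : t *: x = (t / n.+1%:R) *: (n.+1%:R *: x) by rewrite scalerA divfK.
rewrite (le_trans (fdistZ1 _ _))// normf_div normr_nat ler_pdivrMr//.
by rewrite mul1r.
Qed.

End FrechetTheory.

Section LipHom.
Context {R : realType} (E F : frechet R).

Definition lip_quot (L : E -> F) : set R :=
  [set fdist (L x) 0 / fdist x 0 | x in [set x | x != 0]].

Definition lip_linear (L : E -> F) : Prop := linear L /\ has_ubound (lip_quot L).

Definition lip_linear_pred : {pred E -> F} := fun L => `[< lip_linear L >].

(* If [E] is trivial the supremum is taken over the empty set and is 0. *)
Definition Lip (L : E -> F) : R := sup (lip_quot L).

Lemma Lip_le (L : E -> F) c : 0 <= c -> L 0 = 0 ->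
  (forall x, fdist (L x) 0 <= c * fdist x 0) ->
  has_ubound (lip_quot L) /\ Lip L <= c.
Proof.
move=> c0 L0 Lc.
have ub : ubound (lip_quot L) c.
  by move=> _ [x /= x0 <-]; rewrite ler_pdivrMr ?fdist_gt0.
split; first by exists c.
by rewrite /Lip; have [->|/set0P ne] := eqVneq (lip_quot L) set0;
  [rewrite sup0|exact: ge_sup].
Qed.

Lemma le_Lip (L : E -> F) x : lip_linear L ->
  fdist (L x) 0 <= Lip L * fdist x 0.
Proof.
move=> [Ll Lu]; have [->|x0] := eqVneq x 0.
  have -> : L 0 = 0.
    by have := Ll (-1) 0 0; rewrite scaleN1r oppr0 addr0 scaleN1r addNr.
  by rewrite !fdistxx mulr0.
rewrite -ler_pdivrMr ?fdist_gt0//; apply: ub_le_sup => //.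
by exists x.
Qed.

Lemma Lip_ge0 (L : E -> F) : 0 <= Lip L.
Proof.
rewrite /Lip; have [->|/set0P [r Lr]] := eqVneq (lip_quot L) set0.
  by rewrite sup0.
have [u|u] := pselect (has_ubound (lip_quot L)); last first.
  by rewrite sup_out// => -[].
apply: (@le_trans _ _ r); last exact: ub_le_sup.
by case: Lr => x _ <-; rewrite divr_ge0// fdist_ge0.
Qed.

Lemma lip_linear0 (L : E -> F) : linear L -> L 0 = 0.
Proof.
by move=> Ll; have := Ll (-1) 0 0; rewrite scaleN1r oppr0 addr0 scaleN1r addNr.
Qed.

Lemma lip_linear_submod : submod_closed lip_linear_pred.
Proof.
split=> [|a f g /asboolP[fl fu] /asboolP[gl gu]]; apply/asboolP; split.
- by move=> b x y /=; rewrite scaler0 addr0.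
- by case: (@Lip_le 0 0 (lexx 0) erefl) => // x; rewrite fdistxx mul0r.
- move=> b x y; rewrite -[LHS]/(a *: f (b *: x + y) + g (b *: x + y)).
  rewrite -[RHS]/(b *: (a *: f x + g x) + (a *: f y + g y)) fl gl.
  by rewrite !scalerDr !scalerA addrACA [b * a]mulrC.
- have [n na] : exists n : nat, `|a| <= n%:R.
    by exists (Num.truncn `|a|).+1; exact/ltW/truncnS_gt.
  case: (@Lip_le (a *: f + g) (n%:R * Lip f + Lip g)) => //.
  + by rewrite addr_ge0 ?mulr_ge0// Lip_ge0.
  + rewrite -[LHS]/(a *: f 0 + g 0) !lip_linear0//.
    by rewrite scaler0 addr0.
  + move=> x; rewrite mulrDl (le_trans (fdistD _ _))// lerD ?le_Lip//.
    by rewrite (le_trans (fdistZn _ na))// -mulrA ler_wpM2l// le_Lip.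
Qed.

HB.instance Definition _ := GRing.isSubmodClosed.Build R (E -> F)
  lip_linear_pred lip_linear_submod.

Record lipHom := LipHom {
  lipfun :> E -> F;
  lipfunP : lipfun \in lip_linear_pred }.

HB.instance Definition _ := [isSub for lipfun].
HB.instance Definition _ := [Choice of lipHom by <:].
HB.instance Definition _ := [SubChoice_isSubLmodule of lipHom by <:].

Implicit Types L H : lipHom.

Lemma lipHomP L : lip_linear L.
Proof. by apply/asboolP; exact: (valP L). Qed.

Lemma lipHom_le L x : fdist (L x) 0 <= Lip L * fdist x 0.
Proof. exact/le_Lip/lipHomP. Qed.

Lemma Lip_lipHom_le L c : 0 <= c ->
  (forall x, fdist (L x) 0 <= c * fdist x 0) -> Lip L <= c.
Proof.
by move=> c0 Lc; apply: (Lip_le c0 _ Lc).2; apply/lip_linear0/(lipHomP L).1.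
Qed.

Lemma LipD L H : Lip (L + H : lipHom) <= Lip L + Lip H.
Proof.
apply: Lip_lipHom_le => [|x]; first by rewrite addr_ge0 ?Lip_ge0.
by rewrite mulrDl (le_trans (fdistD _ _))// lerD// lipHom_le.
Qed.

Lemma LipN L : Lip (- L : lipHom) = Lip L.
Proof.
have H K : Lip (- K : lipHom) <= Lip K.
  by apply: Lip_lipHom_le => [|x]; rewrite ?Lip_ge0// fdistN lipHom_le.
by apply/le_anti; rewrite H -{1}[L]opprK H.
Qed.

Lemma Lip_conv (a b : R) L H : `|a| + `|b| <= 1 ->
  Lip (a *: L + b *: H : lipHom) <= Num.max (Lip L) (Lip H).
Proof.
move=> ab; apply: Lip_lipHom_le => [|x]; first by rewrite le_max Lip_ge0.
rewrite (le_trans (fdist_conv _ _ ab))// maxr_pMl ?fdist_ge0//.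
by rewrite ge_max !le_max !lipHom_le orbT.
Qed.

Lemma LipZn (n : nat) (t : R) L : `|t| <= n%:R -> Lip (t *: L : lipHom) <= n%:R * Lip L.
Proof.
move=> tn; apply: Lip_lipHom_le => [|x]; first by rewrite mulr_ge0 ?Lip_ge0.
by rewrite (le_trans (fdistZn _ tn))// -mulrA ler_wpM2l// lipHom_le.
Qed.

(* The metric D_{g,d}. *)
Definition lip_dist L H : R := Lip (L - H : lipHom).

Fact lip_distxx L : lip_dist L L = 0.
Proof.
apply/le_anti; rewrite Lip_ge0 andbT /lip_dist subrr.
by apply: Lip_lipHom_le => // x; rewrite fdistxx mul0r.
Qed.

Fact lip_dist_eq L H : lip_dist L H = 0 -> L = H.
Proof.
move=> LH0; apply/val_inj/funext => x; apply/fdist_eq/le_anti.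
rewrite fdist_ge0 andbT fdistB.
by have := lipHom_le (L - H) x; rewrite -/(lip_dist L H) LH0 mul0r.
Qed.

Fact lip_dist_sym L H : lip_dist L H = lip_dist H L.
Proof. by rewrite /lip_dist -LipN opprB. Qed.

Fact lip_dist_triangle H L K : lip_dist L K <= lip_dist L H + lip_dist H K.
Proof. by rewrite /lip_dist -(subrKA H) LipD. Qed.

HB.instance Definition _ := isMetric.Build R lipHom
  lip_distxx lip_dist_eq lip_dist_sym lip_dist_triangle.

End LipHom.

Section LipHom0.
Context {R : realType} (E F : frechet R).
Implicit Types L H : lipHom E F.

Definition lip_component : {pred lipHom E F} :=
  fun L => `[< connected_component [set: lipHom E F] 0 L >].

Lemma nbhs_lipHom L (U : set (lipHom E F)) :
  nbhs L U <-> exists2 e : R, 0 < e & forall H, Lip (L - H : lipHom E F) < e -> U H.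
Proof.
by rewrite -nbhs_ballE; split=> -[e /= e0 eU]; exists e.
Qed.

Lemma lipHom_continuous (f : lipHom E F -> lipHom E F) (n : nat) :
  (forall L H, Lip (f L - f H : lipHom E F) <= n%:R * Lip (L - H : lipHom E F)) ->
  continuous f.
Proof.
move=> fn L U /nbhs_lipHom[e e0 eU]; apply/nbhs_lipHom; exists (e / n.+1%:R).
  by rewrite divr_gt0.
move=> H LH; apply: eU; rewrite (le_lt_trans (fn _ _))//.
rewrite ltr_pdivlMr// in LH; apply: le_lt_trans LH.
by rewrite mulrC ler_wpM2l ?Lip_ge0// ler_nat.
Qed.

Lemma lip_component_submod : submod_closed lip_component.
Proof.
pose C := connected_component [set: lipHom E F] 0.
have C0 : C 0 by exact: connected_component_refl.
have CfC (f : lipHom E F -> lipHom E F) : continuous f -> C (f 0) ->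
    forall L, C L -> C (f L).
  move=> cf Cf0 L CL; apply: (connected_component_trans Cf0).
  exists (f @` C).
    split=> //.
    apply: connected_continuous_connected; last exact: continuous_subspaceT.
    exact: component_connected.
  by exists L.
split=> [|a L H /asboolP CL /asboolP CH]; apply/asboolP => //.
have [n na] : exists n : nat, `|a| <= n%:R.
  by exists (Num.truncn `|a|).+1; exact/ltW/truncnS_gt.
apply: (CfC (fun K => a *: K + H)) => //; last by rewrite scaler0 add0r.
apply: (@lipHom_continuous _ n) => K K'.
by rewrite opprD addrACA subrr addr0 -scalerBr LipZn.
Qed.

HB.instance Definition _ := GRing.isSubmodClosed.Build R (lipHom E F)
  lip_component lip_component_submod.

Record lipHom0 := LipHom0 {
  lipHom_of :> lipHom E F;
  lipHom_ofP : lipHom_of \in lip_component }.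

HB.instance Definition _ := [isSub for lipHom_of].
HB.instance Definition _ := [Choice of lipHom0 by <:].
HB.instance Definition _ := [SubChoice_isSubLmodule of lipHom0 by <:].

Definition lip_dist0 (K K' : lipHom0) : R := mdist (\val K) (\val K').

Fact lip_dist0xx K : lip_dist0 K K = 0. Proof. exact: mdistxx. Qed.

Fact lip_dist0_eq K K' : lip_dist0 K K' = 0 -> K = K'.
Proof. by move/mdist_positivity/val_inj. Qed.

Fact lip_dist0_sym K K' : lip_dist0 K K' = lip_dist0 K' K.
Proof. exact: metric_sym. Qed.

Fact lip_dist0_triangle K' K K'' :
  lip_dist0 K K'' <= lip_dist0 K K' + lip_dist0 K' K''.
Proof. exact: metric_triangle. Qed.

HB.instance Definition _ := isMetric.Build R lipHom0
  lip_dist0xx lip_dist0_eq lip_dist0_sym lip_dist0_triangle.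

Implicit Types K : lipHom0.

Lemma lip_dist0E K K' : lip_dist0 K K' = Lip (K - K' : lipHom0).
Proof. by []. Qed.

Lemma lip_component_small L : L \in lip_component -> forall e : R, 0 < e ->
  exists n : nat, Lip (n.+1%:R^-1 *: L : lipHom E F) < e.
Proof.
move=> /asboolP CL e e0.
pose S := [set L' : lipHom E F |
  exists n : nat, Lip (n.+1%:R^-1 *: L' : lipHom E F) < e].
have oS : open S.
  rewrite openE => L1 [n nL1]; apply/nbhs_lipHom.
  exists (e - Lip (n.+1%:R^-1 *: L1 : lipHom E F)); first by rewrite subr_gt0.
  move=> H; rewrite ltrBrDr => LH; exists n.
  rewrite -[H](subKr L1) scalerBr (le_lt_trans (LipD _ _))// LipN.
  apply: le_lt_trans LH; rewrite addrC lerD2r.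
  have := @LipZn _ _ _ 1 n.+1%:R^-1 (L1 - H); rewrite mul1r; apply.
  by rewrite ger0_norm ?invr_ge0// invf_le1// ler1n.
have cS : closed S.
  move=> L1 /(_ [set H | Lip (L1 - H : lipHom E F) < e]).
  have /[swap]/[apply] : nbhs L1 [set H | Lip (L1 - H : lipHom E F) < e].
    by apply/nbhs_lipHom; exists e.
  move=> -[H [[n nH] L1H]]; exists n.+1.
  have -> : n.+2%:R^-1 *: L1 =
      (n.+1%:R / n.+2%:R) *: (n.+1%:R^-1 *: H) + n.+2%:R^-1 *: (L1 - H) :> lipHom E F.
    rewrite scalerA mulrAC divff// mul1r -scalerDr.
    by rewrite addrC subrK.
  apply: (le_lt_trans (Lip_conv _ _ _)).
    rewrite !ger0_norm ?divr_ge0// -[X in _ + X]mul1r -mulrDl natr1 divff//.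
  by rewrite gt_max nH.
have [B [B0 _ cB] BL] := CL.
have : B `&` S = B.
  apply: cB; [exists 0; split => //|by exists S|by exists S].
  exists 0%N; rewrite scaler0.
  have := lip_distxx (0 : lipHom E F).
  by rewrite /lip_dist subrr => ->.
by move=> /setIidPl; apply.
Qed.

Lemma nbhs_lipHom0 K (U : set lipHom0) :
  nbhs K U <-> exists2 e : R, 0 < e & forall K', lip_dist0 K K' < e -> U K'.
Proof.
by rewrite -nbhs_ballE; split=> -[e /= e0 eU]; exists e.
Qed.

Let lipHom0_add_continuous : continuous (fun K : lipHom0 * lipHom0 => K.1 + K.2).
Proof.
move=> [a b] /= U /= /nbhs_lipHom0[e e0 eU].
exists ([set K | lip_dist0 a K < e / 2], [set K | lip_dist0 b K < e / 2]) => /=.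
  by split; apply/nbhs_lipHom0; exists (e / 2); rewrite ?divr_gt0.
move=> [x y] /= [ax bY]; apply: eU => /=.
rewrite lip_dist0E opprD addrACA [ltRHS]splitr.
exact: le_lt_trans (LipD _ _) (ltrD ax bY).
Qed.

Let lipHom0_scale_continuous :
  continuous (fun z : R^o * lipHom0 => z.1 *: z.2).
Proof.
move=> [a b] /= U /= /nbhs_lipHom0[e e0 eU].
have e20 : 0 < e / 2 by rewrite divr_gt0.
have [m mb] := lip_component_small (lipHom_ofP b) e20.
have [n na] : exists n : nat, `|a| + 1 <= n.+1%:R.
  by exists (Num.truncn (`|a| + 1)); apply/ltW/truncnS_gt.
exists (ball (a : R^o) m.+1%:R^-1, [set K | lip_dist0 b K < e / 2 / n.+1%:R]) => /=.
  split; first by apply: nbhsx_ballx; rewrite invr_gt0.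
  by apply/nbhs_lipHom0; exists (e / 2 / n.+1%:R); rewrite ?divr_gt0.
move=> [t y] /=; rewrite -ball_normE /= => -[tm yb]; apply: eU => /=.
rewrite lip_dist0E.
have -> : a *: b - t *: y = (a - t) *: b + t *: (b - y).
  by rewrite scalerBr scalerBl addrA subrK.
apply: le_lt_trans (LipD ((a - t) *: (b : lipHom E F))
  (t *: (b - y : lipHom E F))) _.
rewrite [ltRHS]splitr; apply: ltrD.
  apply: le_lt_trans mb.
  rewrite [X in Lip X](_ : _ = lipfun (((a - t) * m.+1%:R) *:
    (m.+1%:R^-1 *: (b : lipHom E F)))); last first.
    by rewrite scalerA mulfK.
  have := @LipZn _ _ _ 1 ((a - t) * m.+1%:R) (m.+1%:R^-1 *: (b : lipHom E F)).
  rewrite mul1r; apply.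
  by rewrite normrM normr_nat -ler_pdivlMr// mul1r ltW.
have tn : `|t| <= n.+1%:R.
  apply: le_trans na; rewrite -[t](subrK a) (le_trans (ler_normD _ _))//.
  by rewrite addrC lerD2l distrC (le_trans (ltW tm))// invf_le1// ler1n.
apply: le_lt_trans (LipZn _ tn) _.
by rewrite mulrC -ltr_pdivlMr.
Qed.

HB.instance Definition _ :=
  PreTopologicalNmodule_isTopologicalNmodule.Build lipHom0 lipHom0_add_continuous.
HB.instance Definition _ :=
  TopologicalNmodule_isTopologicalLmodule.Build R lipHom0 lipHom0_scale_continuous.

Lemma fdist_cvg (G : frechet R) (u : nat -> G) (l : G) : u @ \oo --> l ->
  forall e : R, 0 < e -> exists N, forall n, (N <= n)%N -> fdist l (u n) < e.
Proof.
move=> ul e e0; have : nbhs l [set y | fdist l y < e].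
  by rewrite fnbhsE; exists e.
by move=> /ul[N _ NP]; exists N => n /NP.
Qed.

Lemma lipHom_complete (u : nat -> lipHom E F) :
  (forall e : R, 0 < e -> exists N, forall m n, (N <= m)%N -> (N <= n)%N ->
     Lip (u m - u n : lipHom E F) < e) ->
  exists L, forall e : R, 0 < e -> exists N, forall n, (N <= n)%N ->
     Lip (L - u n : lipHom E F) <= e.
Proof.
move=> uC.
have pt (x : E) : exists l : F, (fun n => u n x) @ \oo --> l.
  apply: fcomplete => e e0.
  have x0 : 0 < fdist x 0 + 1 by rewrite ltr_wpDl// fdist_ge0.
  have [N NP] := uC (e / (fdist x 0 + 1)) (divr_gt0 e0 x0).
  exists N => m n Nm Nn; rewrite fdistB.
  apply: le_lt_trans (lipHom_le (u m - u n) x) _.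
  have := NP m n Nm Nn; rewrite ltr_pdivlMr// => /(le_lt_trans _); apply.
  by rewrite ler_wpM2l ?Lip_ge0// lerDl.
pose l x := sval (cid (pt x)).
have lP x : (fun n => u n x) @ \oo --> l x := svalP (cid (pt x)).
have lu e : 0 < e -> exists N, forall n x, (N <= n)%N ->
    fdist (l x - u n x) 0 <= e * fdist x 0.
  move=> e0; have [N NP] := uC e e0; exists N => n x Nn.
  apply/ler_addgt0Pl => d d0; have [N' N'P] := fdist_cvg (lP x) d0.
  pose m := maxn N N'; rewrite -fdistB (le_trans (fdist_triangle (u m x) _ _))//.
  apply: lerD; first by apply/ltW/N'P/leq_maxr.
  rewrite fdistB (le_trans (lipHom_le (u m - u n) x))// ler_wpM2r ?fdist_ge0//.
  by apply/ltW/NP; rewrite ?leq_maxl.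
have llin : linear l.
  move=> a x y; apply: fdist_eq; apply/le_anti; rewrite fdist_ge0 andbT.
  have [k ka] : exists k : nat, `|a| <= k%:R.
    by exists (Num.truncn `|a|).+1; exact/ltW/truncnS_gt.
  pose c := fdist (a *: x + y) 0 + (k%:R * fdist x 0 + fdist y 0) + 1.
  have c0 : 0 < c.
    by rewrite /c ltr_wpDl// !addr_ge0 ?mulr_ge0 ?fdist_ge0.
  apply/ler_addgt0Pl => e e0; rewrite addr0.
  have [N NP] := lu (e / c) (divr_gt0 e0 c0).
  have -> : e = e / c * c by rewrite divfK// gt_eqF.
  pose v := u N; have vl : linear v := (lipHomP v).1.
  rewrite fdistB.
  have -> : l (a *: x + y) - (a *: l x + l y) =
     (l (a *: x + y) - v (a *: x + y)) + (- (a *: (l x - v x)) + - (l y - v y)).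
    rewrite vl -opprD scalerBr [a *: l x - _ + _]addrACA -opprD opprB.
    by rewrite subrKA.
  apply: le_trans (fdistD _ _) _.
  rewrite [in leRHS]/c -[X in _ * X]addrA mulrDr -/c.
  apply: lerD; first exact: NP.
  apply: le_trans (fdistD _ _) _; rewrite !fdistN.
  apply: (@le_trans _ _ (k%:R * (e / c * fdist x 0) + e / c * fdist y 0)).
    apply: lerD; last exact: NP.
    by apply: le_trans (fdistZn _ ka) _; rewrite ler_wpM2l// NP.
  rewrite mulrCA -mulrDr ler_wpM2l ?divr_ge0 ?ltW//.
  by rewrite ltrDl.
have lip_l : l \in @lip_linear_pred R E F.
  apply/asboolP; split=> //; have [N NP] := lu 1 ltr01.
  have [] // := @Lip_le _ _ _ l (1 + Lip (u N)).
  - by rewrite addr_ge0 ?Lip_ge0.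
  - exact: lip_linear0.
  move=> x; rewrite -[l x](subrK (u N x)) (le_trans (fdistD _ _))//.
  by rewrite mulrDl lerD ?NP ?lipHom_le.
exists (LipHom lip_l) => e e0; have [N NP] := lu e e0; exists N => n Nn.
by apply: Lip_lipHom_le => [|x]; [exact: ltW|exact: NP].
Qed.

Lemma lipHom0_complete (u : nat -> lipHom0) :
  (forall e : R, 0 < e -> exists N, forall m n, (N <= m)%N -> (N <= n)%N ->
     lip_dist0 (u m) (u n) < e) ->
  exists K, u @ \oo --> K.
Proof.
move=> /lipHom_complete[L LP].
have CL : L \in lip_component.
  apply/asboolP/component_closed; first exact: closedT.
  move=> U /nbhs_lipHom[e e0 eU].
  have [N NP] : exists N, forall n, (N <= n)%N ->
      Lip (L - \val (u n) : lipHom E F) <= e / 2 by apply: LP; rewrite divr_gt0.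
  exists (\val (u N)); split; first exact/asboolP/(lipHom_ofP (u N)).
  apply: eU; rewrite (le_lt_trans (NP N _))//.
  by rewrite ltr_pdivrMr// mulr_natr mulr2n ltrDl.
exists (LipHom0 CL) => U /nbhs_lipHom0[e e0 eU].
have [N NP] : exists N, forall n, (N <= n)%N ->
      Lip (L - \val (u n) : lipHom E F) <= e / 2 by apply: LP; rewrite divr_gt0.
exists N => // n /= Nn; apply: eU.
apply: (le_lt_trans (NP n Nn)).
by rewrite ltr_pdivrMr// mulr_natr mulr2n ltrDl.
Qed.

Lemma lip_dist0D2r K'' K K' : lip_dist0 (K + K'') (K' + K'') = lip_dist0 K K'.
Proof. by rewrite !lip_dist0E opprD addrACA subrr addr0. Qed.

Lemma lip_ball0_convex r : absolutely_convex [set K | lip_dist0 K 0 < r].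
Proof.
move=> a b K K' ab /=; rewrite !lip_dist0E !subr0 => Kr K'r.
by rewrite (le_lt_trans (Lip_conv _ _ ab))// gt_max Kr.
Qed.

Lemma lipHom0_nbhsE K : nbhs K =
  filter_from [set e : R | 0 < e] (fun e => [set K' | lip_dist0 K K' < e]).
Proof.
by apply/seteqP; split=> U /nbhs_lipHom0.
Qed.

(* The connected component of the zero map, as a Frechet space. *)
Definition lipHom0_frechet : frechet R :=
  @Frechet R lipHom0 lip_dist0 lip_dist0xx lip_dist0_eq
    lip_dist0_sym lip_dist0_triangle lip_dist0D2r lip_ball0_convex
    lipHom0_nbhsE lipHom0_complete.

End LipHom0.

Section MCmaps.
Context {R : realType}.

Section Differentiability.
Context {E F : frechet R}.
Implicit Types (U : set E) (P : E -> F).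

Definition diff_quot P (p h : E) (t : R) : F := t^-1 *: (P (p + t *: h) - P p).

Definition dir_derivable P (p h : E) : Prop :=
  exists l : F, diff_quot P p h t @[t --> (0 : R)^'] --> l.

Definition dir_derive P (p h : E) : F :=
  xget 0 [set l : F | diff_quot P p h t @[t --> (0 : R)^'] --> l].

(* A map on an open set U is encoded by a total map; only its values on U
   matter, and so do those of [dir_derive P] since U is open. *)
Definition Keller_differentiable U P : Prop :=
  [/\ {within U, continuous P},
      forall p h, U p -> dir_derivable P p h,
      forall p, U p -> linear (dir_derive P p) /\ continuous (dir_derive P p),
      {within U, continuous (dir_derive P : E -> {compact-open, E -> F})} &
      {within U `*` setT, continuous (fun uh : E * E => dir_derive P uh.1 uh.2)}].

Definition bounded_differentiable U P : Prop :=
  Keller_differentiable U P /\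
  exists D : E -> lipHom E F,
    (forall p, U p -> forall h, D p h = dir_derive P p h) /\
    {within U, continuous D}.

End Differentiability.

Fixpoint MC (k : nat) (E F : frechet R) (U : set E) (P : E -> F) : Prop :=
  match k with
  | 0%N => {within U, continuous P}
  | 1%N => bounded_differentiable U P
  | (_.+1 as k').+1 => bounded_differentiable U P /\
      forall x0, U x0 -> exists (V : set E) (Q : E -> lipHom0 E F),
        [/\ open_nbhs x0 V, connected V, V `<=` U,
            forall x, V x -> forall h, Q x h = dir_derive P x h - dir_derive P x0 h
          & @MC k' E (lipHom0_frechet E F) V Q]
  end.

(* [Some k] stands for the order k and [None] for the order infinity. *)
Definition MCx (k : option nat) (E F : frechet R) (U : set E) (P : E -> F) :=
  if k is Some k' then MC k' U P else forall k', MC k' U P.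

End MCmaps.

Record chart (X Y : topologicalType) := Chart {
  cdom : set X;
  cmap : X -> Y;
  cinv : Y -> X;
  cdom_open : open cdom;
  cimage_open : open (cmap @` cdom);
  cmapK : {in cdom, cancel cmap cinv};
  cmap_continuous : {within cdom, continuous cmap};
  cinv_continuous : {within cmap @` cdom, continuous cinv}
}.

Definition overlap (X Y Z : topologicalType) (c : chart X Y) (c' : chart X Z) :
  set Y := cmap c @` (cdom c `&` cdom c').

Definition transition (X Y Z : topologicalType) (c : chart X Y)
  (c' : chart X Z) : Y -> Z := cmap c' \o cinv c.

Record frechet_atlas (R : realType) (X : topologicalType) := FrechetAtlas {
  aidx : Type;
  amodel : aidx -> frechet R;
  achart : forall i, chart X (amodel i)
}.
Arguments achart {R X} _ _.

Definition MC_frechet_manifold (R : realType) (k : option nat)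
    (X : topologicalType) (A : frechet_atlas R X) : Prop :=
  [/\ k != Some 0%N, hausdorff_space X,
      \bigcup_i cdom (achart A i) = setT &
      forall i j, MCx k (overlap (achart A i) (achart A j))
                        (transition (achart A i) (achart A j))].

Definition bounded_frechet_manifold (R : realType) (X : topologicalType)
  (A : frechet_atlas R X) : Prop := exists k, MC_frechet_manifold k A.

Section Smooth.
Context {R : realType} {n : nat} {W : normedModType R}.

Fixpoint Ck (k : nat) (O : set 'rV[R]_n) (f : 'rV[R]_n -> W) : Prop :=
  if k is k'.+1 then
    (forall x, O x -> differentiable f x) /\ (forall v, Ck k' O ('D_v f))
  else {within O, continuous f}.

Definition smooth_on (O : set 'rV[R]_n) (f : 'rV[R]_n -> W) : Prop :=
  forall k, Ck k O f.

Definition iter_partial (s : seq 'I_n) (f : 'rV[R]_n -> W) : 'rV[R]_n -> W :=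
  foldr (fun (i : 'I_n) g => 'D_(delta_mx 0 i) g) f s.

End Smooth.

Record smooth_manifold (R : realType) (n : nat) := SmoothManifold {
  mspace :> topologicalType;
  midx : Type;
  mchart : midx -> chart mspace 'rV[R]_n;
  m_hausdorff : hausdorff_space mspace;
  m_second_countable : @second_countable mspace;
  mchart_cover : \bigcup_i cdom (mchart i) = setT;
  mchart_smooth : forall i j,
    smooth_on (overlap (mchart i) (mchart j)) (transition (mchart i) (mchart j))
}.

Section TangentSpace.
Context {R : realType} {n : nat} (M : smooth_manifold R n).
Implicit Types (i j : midx M) (p : M).

(* Vectors are rows: coordinates v in the chart i become [v *m chart_jac i j p]
   in the chart j. *)
Definition chart_jac i j p : 'M[R]_n :=
  'J (transition (mchart i) (mchart j)) (cmap (mchart i) p).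

(* A tangent vector at p is the family of its coordinates in all the charts
   around p; the entries at the other charts are irrelevant, and set to 0. *)
Definition tangent_axiom p (v : midx M -> 'rV[R]_n) : Prop :=
  (forall i, ~ cdom (mchart i) p -> v i = 0) /\
  (forall i j, cdom (mchart i) p -> cdom (mchart j) p ->
     v j = v i *m chart_jac i j p).

Definition tangent_pred p : {pred midx M -> 'rV[R]_n} :=
  fun v => `[< tangent_axiom p v >].

Lemma tangent_submod p : submod_closed (tangent_pred p).
Proof.
split=> [|a u v /asboolP[u0 uJ] /asboolP[v0 vJ]]; apply/asboolP; split.
- by [].
- by move=> i j _ _; rewrite -[LHS]/(0 : 'rV_n) -[X in X *m _]/(0 : 'rV_n) mul0mx.
- move=> i ip; rewrite -[LHS]/(a *: u i + v i) u0// v0//.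
  by rewrite scaler0 addr0.
- move=> i j ip jp; rewrite -[LHS]/(a *: u j + v j).
  rewrite -[X in X *m _]/(a *: u i + v i) (uJ i j)// (vJ i j)//.
  by rewrite mulmxDl -scalemxAl.
Qed.

HB.instance Definition _ p := GRing.isSubmodClosed.Build R
  (midx M -> 'rV[R]_n) (tangent_pred p) (tangent_submod p).

Record tangent p := Tangent {
  tcoord :> midx M -> 'rV[R]_n;
  tcoordP : tcoord \in tangent_pred p }.

HB.instance Definition _ p := [isSub for @tcoord p].
HB.instance Definition _ p := [Choice of tangent p by <:].
HB.instance Definition _ p := [SubChoice_isSubLmodule of tangent p by <:].

Definition coord_fun i p (w : 'rV[R]_n) (j : midx M) : 'rV[R]_n :=
  if `[< cdom (mchart i) p /\ cdom (mchart j) p >]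
  then w *m chart_jac i j p else 0.

Lemma near_overlap i j p : cdom (mchart i) p -> cdom (mchart j) p ->
  \forall x \near cmap (mchart i) p, cdom (mchart j) (cinv (mchart i) x) /\
    (cmap (mchart i) @` cdom (mchart i)) x.
Proof.
move=> ip jp; set c := mchart i; set c' := mchart j.
have ci : (cmap c @` cdom c) (cmap c p) by exists p.
have near1 : \forall x \near cmap c p, (cmap c @` cdom c) x.
  exact: open_nbhs_nbhs (conj (cimage_open c) ci).
have := @cinv_continuous _ _ c; rewrite continuous_open_subspace; last first.
  exact: cimage_open.
move=> /(_ (cmap c p)); rewrite inE => /(_ ci) /(_ (cdom c')).
rewrite cmapK ?inE// => H; near=> x; split; near: x => //.
by apply: H; exact: open_nbhs_nbhs (conj (cdom_open c') jp).
Unshelve. all: by end_near. Qed.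

Lemma transition_diff i j p : cdom (mchart i) p -> cdom (mchart j) p ->
  differentiable (transition (mchart i) (mchart j)) (cmap (mchart i) p).
Proof.
move=> ip jp; apply: ((@mchart_smooth _ _ M i j) 1%N).1.
by exists p.
Qed.

Lemma chart_jacM i j k p :
  cdom (mchart i) p -> cdom (mchart j) p -> cdom (mchart k) p ->
  chart_jac i j p *m chart_jac j k p = chart_jac i k p.
Proof.
move=> ip jp kp; apply/row_matrixP => l; rewrite !rowE; set v := delta_mx 0 l.
have tE : transition (mchart i) (mchart j) (cmap (mchart i) p) = cmap (mchart j) p.
  by rewrite /transition /= cmapK ?inE.
have dj : differentiable (transition (mchart j) (mchart k))
    (transition (mchart i) (mchart j) (cmap (mchart i) p)).
  by rewrite tE; exact: transition_diff.
have di := transition_diff ip jp.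
rewrite mulmxA /chart_jac -[RHS]deriveEjacobian; last exact: transition_diff.
have nE : \forall x \near cmap (mchart i) p,
    transition (mchart i) (mchart k) x =
    (transition (mchart j) (mchart k) \o transition (mchart i) (mchart j)) x.
  near=> x; have [jx _] : cdom (mchart j) (cinv (mchart i) x) /\
    (cmap (mchart i) @` cdom (mchart i)) x by near: x; exact: near_overlap.
  by rewrite /transition /= cmapK ?inE.
rewrite (near_eq_derive _ nE) deriveE; last exact: differentiable_comp.
rewrite diff_comp//= tE.
rewrite -deriveE; last by rewrite -tE.
rewrite deriveEjacobian; last by rewrite -tE.
by rewrite -deriveE// deriveEjacobian.
Unshelve. all: by end_near. Qed.

Lemma chart_jacxx i p : cdom (mchart i) p -> chart_jac i i p = 1%:M.
Proof.
move=> ip; apply/row_matrixP => l; rewrite !rowE; set v := delta_mx 0 l.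
rewrite /chart_jac -deriveEjacobian; last exact: transition_diff.
have nE : \forall x \near cmap (mchart i) p,
    transition (mchart i) (mchart i) x = id x.
  near=> x; have [_ [q iq <-]] : cdom (mchart i) (cinv (mchart i) x) /\
    (cmap (mchart i) @` cdom (mchart i)) x by near: x; exact: near_overlap.
  by rewrite /transition /= cmapK ?inE.
by rewrite (near_eq_derive _ nE) derive_id mulmx1.
Unshelve. all: by end_near. Qed.

Lemma coord_funP i p w : coord_fun i p w \in tangent_pred p.
Proof.
apply/asboolP; split=> [j jp|j k jp kp]; rewrite /coord_fun.
  by case: asboolP => // -[].
have [ip|ip] := pselect (cdom (mchart i) p); last first.
  by rewrite !asboolF ?mul0mx// => -[].
rewrite !asboolT; [|by split|by split].
rewrite -mulmxA; congr (_ *m _); exact/esym/chart_jacM.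
Qed.

(* The tangent vector at p with coordinates w in the chart i (0 if p is outside
   the domain of i). *)
Definition coord_vec i p w : tangent p := Tangent (coord_funP i p w).

Lemma coord_vecE i p w : cdom (mchart i) p -> coord_vec i p w i = w.
Proof.
move=> ip; rewrite /= /coord_fun asboolT; last by split.
by rewrite chart_jacxx// mulmx1.
Qed.

End TangentSpace.
Arguments coord_vec {R n M} i p w.

Section Tensors.
Context {R : realType} {n : nat} (M : smooth_manifold R n).

Definition form_field : Type := forall p : M, tangent p -> tangent p -> R.

Definition form_components (h : form_field) (i : midx M) (x : 'rV[R]_n) :
    'M[R]_n :=
  \matrix_(k, l) let p := cinv (mchart i) x in
    h p (coord_vec i p (delta_mx 0 k)) (coord_vec i p (delta_mx 0 l)).

Record sym2_section := Sym2Section {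
  form : form_field;
  form_sym : forall p (u v : tangent p), form u v = form v u;
  form_linear : forall p (u : tangent p), linear (form u : tangent p -> R^o);
  form_smooth : forall i, smooth_on (cmap (mchart i) @` cdom (mchart i))
    (form_components (@form) i)
}.

HB.instance Definition _ := gen_eqMixin sym2_section.
HB.instance Definition _ := gen_choiceMixin sym2_section.

Definition chart_compacts (i : midx M) (K : set 'rV[R]_n) : Prop :=
  compact K /\ K `<=` cmap (mchart i) @` cdom (mchart i).

Definition jets (h : sym2_section) : prod_topology
    (fun q : midx M * seq 'I_n => {family chart_compacts q.1, 'rV[R]_n -> 'M[R]_n})
  := fun q => iter_partial q.2 (form_components (@form h) q.1).

(* The C^oo topology: uniform convergence of all partial derivatives of the
   components on the compact subsets of every chart. *)
HB.instance Definition _ := Topological.copy sym2_section (initial_topology jets).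

Definition riemannian_metrics : set sym2_section :=
  [set g | forall (p : M) (v : tangent p), v != 0 -> 0 < form g v v].

End Tensors.
Arguments riemannian_metrics {R n} M.

(* Main.v *)
Require Import Defs.
From HB Require Import structures.
From mathcomp Require Import all_boot all_order all_algebra.
From mathcomp Require Import all_classical all_reals all_analysis.
From mathcomp Require Import lra ring.

Import Order.TTheory GRing.Theory Num.Theory.
Import numFieldNormedType.Exports.

Local Open Scope classical_set_scope.
Local Open Scope ring_scope.

Set Implicit Arguments.
Unset Strict Implicit.
Unset Printing Implicit Defensive.

(* The metrics form an open subset of the vector space S of smooth symmetric
   (0,2)-tensors, so once S is a Frechet space the inclusion is a global
   chart, its transition map is the identity, and the identity is MC^oo since
   its derivative is constant.

   The C^oo topology of S involves every chart of an arbitrary atlas. By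
   compactness finitely many charts i, with compact sets K_i whose interiors
   cover M, suffice: the components in a chart j are the pullback of those in
   i by the change of chart, so by the chain rule their partial derivatives
   of order m are combinations, with smooth coefficients, of the partial
   derivatives of order at most m in i, and are locally bounded by the
   latter. The values |d^s h(x)|, for x in K_i, are then seminorms graded by
   the order of s, which define the topology and yield a standard metric;
   completeness holds because locally uniform limits commute with
   differentiation, and openness because a continuous positive definite form
   is bounded below on K_i times the unit sphere. *)

Section AffineMaps.
Context {R : realType}.
Implicit Types E F : frechet R.

Lemma nbhs_fdistP E (x : E) (U : set E) :
  nbhs x U <-> exists2 e : R, 0 < e & forall y, fdist x y < e -> U y.
Proof. by rewrite fnbhsE. Qed.

Lemma frechet_hausdorff E : hausdorff_space E.
Proof.
move=> x y xy; apply/fdist_eq/le_anti; rewrite fdist_ge0 andbT.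
apply/ler_addgt0Pl => e e0; rewrite addr0.
have e20 : 0 < e / 2 by rewrite divr_gt0.
have nball z : nbhs z [set t : E | fdist z t < e / 2].
  by apply/nbhs_fdistP; exists (e / 2).
have [z [/= xz yz]] := xy _ _ (nball x) (nball y).
rewrite (le_trans (fdist_triangle z _ _))// [leRHS]splitr lerD ?ltW//.
by rewrite fdist_sym.
Qed.

Lemma open_fball E (x : E) (r : R) : open [set y | fdist x y < r].
Proof.
rewrite openE => y /= xy; apply/nbhs_fdistP; exists (r - fdist x y).
  by rewrite subr_gt0.
by move=> z; rewrite ltrBrDl; apply/le_lt_trans/fdist_triangle.
Qed.

Lemma continuous_line (E : topologicalLmodType R) (x v : E) :
  continuous (fun t : R => x + t *: v).
Proof.
move=> t; apply: (continuous2_cvg _ (@add_continuous E (x, t *: v))).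
  exact: cvg_cst.
apply: (continuous2_cvg _ (@scale_continuous R E (t, v))).
  exact: cvg_id.
exact: cvg_cst.
Qed.

Lemma connected_fball E (x : E) (r : R) :
  0 < r -> connected [set y | fdist x y < r].
Proof.
move=> r0; set B := (X in connected X).
pose segment y := (fun t : R => x + t *: (y - x)) @` `[0, 1]%classic.
have -> : B = \bigcup_(y in B) segment y.
  apply/seteqP; split=> [y By|_ [y By [t + <-]]].
    exists y => //; exists 1; first by rewrite /= in_itv/= ler01 lexx.
    by rewrite scale1r addrC subrK.
  rewrite /= in_itv/= => /andP[t0 t1].
  rewrite /B/= fdist_sym fdistB addrC addKr.
  by rewrite (le_lt_trans (fdistZ1 _ _)) ?ger0_norm// -fdistB fdist_sym.
apply: bigcup_connected => [|y _].
  exists x => y _; exists 0; first by rewrite /= in_itv/= lexx ler01.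
  by rewrite scale0r addr0.
apply: connected_continuous_connected; first exact: segment_connected.
exact/continuous_subspaceT/continuous_line.
Qed.

Lemma lipHomB E F (L : lipHom E F) x y : L (x - y) = L x - L y.
Proof. by rewrite addrC -scaleN1r (lipHomP L).1 scaleN1r addrC. Qed.

Lemma lipHomZ E F (L : lipHom E F) t x : L (t *: x) = t *: L x.
Proof.
have Ll := (lipHomP L).1.
by rewrite -[t *: x]addr0 Ll (lip_linear0 Ll) addr0.
Qed.

Lemma continuous_lipHom E F (L : lipHom E F) : continuous L.
Proof.
move=> x U /nbhs_fdistP[e e0 eU]; apply/nbhs_fdistP.
have c0 : 0 < Lip L + 1 by rewrite ltr_wpDl// Lip_ge0.
exists (e / (Lip L + 1)); first by rewrite divr_gt0.
move=> y; rewrite ltr_pdivlMr// => xy; apply: eU.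
rewrite fdistB -lipHomB (le_lt_trans (lipHom_le _ _))// -fdistB.
by rewrite (le_lt_trans _ xy)// mulrC ler_wpM2l ?fdist_ge0// lerDl.
Qed.

Lemma cvg_dir_derive E F (P : E -> F) p h l :
  diff_quot P p h t @[t --> (0 : R)^'] --> l -> dir_derive P p h = l.
Proof.
move=> Pl; apply: xget_unique => // l' Pl'.
exact: (cvg_unique (@frechet_hausdorff F) Pl' Pl).
Qed.

Section AffineOnOpen.
Context {E F : frechet R} {U : set E} {L : lipHom E F} {b : F} {P : E -> F}.
Hypotheses (oU : open U) (PE : forall x, U x -> P x = L x + b).

Lemma affine_cvg_diff_quot p h : U p ->
  diff_quot P p h t @[t --> (0 : R)^'] --> L h.
Proof.
move=> Up; apply: cvg_near_cst.
have nU : \forall t \near (0 : R), U (p + t *: h).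
  have := @continuous_line E p h 0; rewrite /continuous_at scale0r addr0; apply.
  exact: open_nbhs_nbhs.
near=> t; have Ut : U (p + t *: h) by near: t; exact: nbhs_dnbhs.
rewrite /diff_quot !PE// opprD addrACA subrr addr0 -lipHomB [p + _]addrC addrK.
have t0 : t != 0 by near: t; exact: nbhs_dnbhs_neq.
by rewrite lipHomZ scalerA mulVf// scale1r.
Unshelve. all: by end_near. Qed.

Lemma affine_dir_derivable p h : U p -> dir_derivable P p h.
Proof. by move=> Up; exists (L h); exact: affine_cvg_diff_quot. Qed.

Lemma affine_dir_derive p : U p -> dir_derive P p = L.
Proof.
by move=> Up; apply/funext => h; exact/cvg_dir_derive/affine_cvg_diff_quot.
Qed.

Lemma affine_continuous : {within U, continuous P}.
Proof.
apply: (@subspace_eq_continuous _ _ _ (fun x => L x + b)).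
  by move=> x; rewrite inE => Ux; rewrite /from_subspace PE.
apply: continuous_subspaceT => x.
apply: (continuous2_cvg _ (@add_continuous F (L x, b))).
  exact: continuous_lipHom.
exact: cvg_cst.
Qed.

Lemma affine_bounded_differentiable : bounded_differentiable U P.
Proof.
split; last first.
  exists (fun=> L); split=> [p Up h|]; first by rewrite affine_dir_derive.
  by apply: continuous_subspaceT => x; exact: cvg_cst.
split.
- exact: affine_continuous.
- exact: affine_dir_derivable.
- move=> p /affine_dir_derive ->; split; first exact: (lipHomP L).1.
  exact: continuous_lipHom.
- apply: (@subspace_eq_continuous _ _ _
    (fun=> (L : E -> F) : {compact-open, E -> F})).
    by move=> x; rewrite inE => Ux; rewrite /from_subspace affine_dir_derive.
  by apply: continuous_subspaceT => x; exact: cvg_cst.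
- apply: (@subspace_eq_continuous _ _ _ (fun uh : E * E => L uh.2)).
    move=> [x h]; rewrite inE => -[/= Ux _].
    by rewrite /from_subspace/= affine_dir_derive.
  apply: continuous_subspaceT => x.
  by apply: continuous_comp; [exact: cvg_snd|exact: continuous_lipHom].
Qed.

End AffineOnOpen.

(* The differential of an affine map is constant, so x |-> dP(x) - dP(x0) is 0,
   which is again affine. *)
Lemma affine_MC k E F (U : set E) (L : lipHom E F) (b : F) (P : E -> F) :
  open U -> (forall x, U x -> P x = L x + b) -> MC k U P.
Proof.
elim: k F U L b P => [|[|k] IH] F U L b P oU PE.
- exact: affine_continuous PE.
- exact: affine_bounded_differentiable PE.
split=> [|x0 Ux0]; first exact: affine_bounded_differentiable PE.
have /nbhs_fdistP[e e0 eU] : nbhs x0 U by exact: open_nbhs_nbhs.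
exists [set y | fdist x0 y < e], (fun=> 0); split.
- by split; [exact: open_fball|rewrite /= fdistxx].
- exact: connected_fball.
- exact: eU.
- by move=> x /eU Ux h; rewrite !(affine_dir_derive oU PE) ?subrr.
- apply: (IH _ _ (0 : lipHom E (lipHom0_frechet E F)) 0) => [|x _].
    exact: open_fball.
  by rewrite addr0.
Qed.

Fact id_lip_linear E : (id : E -> E) \in @lip_linear_pred R E E.
Proof.
apply/asboolP; split=> //.
by have [|] // := @Lip_le R E E id 1 ler01 erefl; move=> x; rewrite mul1r.
Qed.

Definition id_lipHom E : lipHom E E := LipHom (id_lip_linear E).

End AffineMaps.

Section MatrixNorm.
Context {R : realType} {p q : nat}.
Implicit Types A : 'M[R]_(p, q).

Lemma le_mx_norm A i j : `|A i j| <= `|A|.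
Proof.
by rewrite [leRHS]/Num.Def.normr/= mx_normrE; exact: (le_bigmax _ _ (i, j)).
Qed.

Lemma mx_norm_le A c : 0 <= c -> (forall i j, `|A i j| <= c) -> `|A| <= c.
Proof.
move=> c0 Ac; rewrite [leLHS]/Num.Def.normr/= mx_normrE.
by apply: bigmax_le => // -[i j] _; exact: Ac.
Qed.

End MatrixNorm.

Section Differentiability.
Context {R : realType} {V W : normedModType R}.
Implicit Types f g : V -> W.

Lemma is_diff_normP f x (df : {linear V -> W}) : continuous df ->
  is_diff x f df <-> forall e, 0 < e ->
    \forall h \near (0 : V), `|f (h + x) - f x - df h| <= e * `|h|.
Proof.
move=> cdf; split=> [[/diff_locallyP[_ fx] dfE] e e0|fx].
  rewrite dfE in fx; have /eqaddoP/(_ _ e0) := fx; apply: filterS => h /=.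
  by rewrite -[X in `|X| <= _]/(f (h + x) - (f x + df h)) opprD addrA.
have fE : f \o shift x = cst (f x) + df +o_ 0 id.
  apply/eqaddoP => e e0; apply: filterS (fx _ e0) => h /=.
  by rewrite -[X in _ -> `|X| <= _]/(f (h + x) - (f x + df h)) opprD addrA.
have dfE := diff_unique cdf fE; split=> //.
by apply/diff_locallyP; rewrite dfE.
Qed.

Lemma near_eq_differentiable f g x : (\near x, f x = g x) ->
  differentiable f x -> differentiable g x.
Proof.
move=> fg df; have cdf := diff_continuous df.
have dfx : is_diff x f ('d f x) by [].
have fx := (is_diff_normP f x cdf).1 dfx.
suff: is_diff x g ('d f x) by case.
apply/(is_diff_normP g x cdf) => e /fx.
have : \forall h \near (0 : V), f (h + x) = g (h + x).
  have := fg; rewrite (near_shift 0)/=.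
  by under [X in X -> _]eq_near do rewrite subr0.
by apply: filterS2 => h <-; rewrite (nbhs_singleton fg).
Qed.

Let line_quot f (x h : V) (t : R) :
  (fun s : R => s^-1 *: (f (x + (s *: 1 + t) *: h) - f (x + t *: h))) =
  (fun s => s^-1 *: (f (s *: h + (x + t *: h)) - f (x + t *: h))).
Proof. by apply/funext => s; rewrite /= [s *: 1]mulr1 scalerDl addrCA. Qed.

Lemma derive_line f (x h : V) (t : R) :
  'D_1 (fun t : R => f (x + t *: h)) t = 'D_h f (x + t *: h).
Proof. by rewrite /derive -line_quot. Qed.

Lemma derivable_line f (x h : V) (t : R) :
  derivable f (x + t *: h) h -> derivable (fun t : R => f (x + t *: h)) t 1.
Proof. by rewrite /derivable -line_quot. Qed.

End Differentiability.

Lemma mean_value_le {R : realType} {V : normedModType R} {p q : nat}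
    (f : V -> 'M[R]_(p, q)) (x h : V) (w : 'M[R]_(p, q)) (c : R) :
  0 <= c ->
  (forall t : R, 0 <= t <= 1 -> differentiable f (x + t *: h)) ->
  (forall t : R, 0 <= t <= 1 -> `|'D_h f (x + t *: h) - w| <= c) ->
  `|f (x + h) - f x - w| <= c.
Proof.
move=> c0 df Df; apply: mx_norm_le => // i j; rewrite !mxE.
pose fij (t : R) : R := f (x + t *: h) i j.
have dfij (t : R) : 0 <= t <= 1 -> is_derive t 1 fij ('D_h f (x + t *: h) i j).
  move=> t01; have dl : derivable (fun t : R => f (x + t *: h)) t 1.
    exact/derivable_line/diff_derivable/df.
  apply: DeriveDef; first by have /derivable_mxP := dl; exact.
  by rewrite -derive_line derive_mx// mxE.
have [t|t|t t01] :=
    @MVT_segment R fij (fun t => 'D_h f (x + t *: h) i j) 0 1 ler01.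
- by rewrite in_itv/= => /andP[t0 t1]; apply: dfij; rewrite !ltW.
- by apply: derivable_within_continuous => // s; rewrite in_itv/= => /dfij [].
rewrite subr0 mulr1 /fij scale1r scale0r addr0 => ->.
have := le_mx_norm ('D_h f (x + t *: h) - w) i j; rewrite !mxE => /le_trans.
by apply; apply: Df; move: t01; rewrite in_itv.
Qed.

Lemma continuous_near_dist_lt {R : realType} {X : topologicalType}
    {W : normedModType R} (f : X -> W) x e :
  {for x, continuous f} -> 0 < e -> \forall y \near x, `|f x - f y| < e.
Proof. by move=> /cvgrPdist_lt fx /fx. Qed.

Definition locally_unif_cvg {R : realType} {T : Type} {X : topologicalType}
    {W : normedModType R} (F : set_system T) (f : T -> X -> W) (g : X -> W)
    (x : X) : Prop :=
  forall e : R, 0 < e -> \forall y \near x & t \near F, `|g y - f t y| < e.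

Section LocallyUniformLimits.
Context {R : realType} {T : Type} {F : set_system T} {FF : ProperFilter F}.

Lemma locally_unif_cvg_cst {X : topologicalType} {W : normedModType R}
    (f : T -> X -> W) (g : X -> W) (x : X) : {for x, continuous g} ->
  locally_unif_cvg F f g x -> locally_unif_cvg F f (fun=> g x) x.
Proof.
move=> cg fg e e0; have e20 : 0 < e / 2 by rewrite divr_gt0.
have [[A B] /= [nA FB] AB] := fg _ e20.
exists (A `&` [set y | `|g x - g y| < e / 2], B) => /=.
  by split=> //; apply: filterI => //; exact: continuous_near_dist_lt.
move=> [y t] /= [[Ay xy] Bt]; have /= yt := AB (y, t) (conj Ay Bt).
by rewrite -(subrKA (g y)) [ltRHS]splitr (le_lt_trans (ler_normD _ _))// ltrD.
Qed.

Lemma locally_unif_limit_continuous {X : topologicalType} {W : normedModType R}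
    (f : T -> X -> W) (g : X -> W) (x : X) :
  (forall t, {for x, continuous (f t)}) -> locally_unif_cvg F f g x ->
  {for x, continuous g}.
Proof.
move=> cf fg; apply/(@cvgrPdist_lt _ _ _ (nbhs x)) => e e0.
have e30 : 0 < e / 3 by rewrite divr_gt0.
have [[A B] /= [nA /filter_ex[t Bt]] AB] := fg _ e30.
have ct := continuous_near_dist_lt (cf t) e30.
apply: filterS2 (nA) ct => y Ay xy.
have /= gx := AB (x, t) (conj (nbhs_singleton nA) Bt).
have /= gy := AB (y, t) (conj Ay Bt).
have -> : g x - g y = (g x - f t x) + ((f t x - f t y) + - (g y - f t y)).
  by rewrite opprB subrKA subrKA.
rewrite (le_lt_trans (ler_normD _ _))//.
have -> : e = e / 3 + (e / 3 + e / 3) by lra.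
by rewrite ltrD// (le_lt_trans (ler_normD _ _))// ltrD// normrN.
Qed.

Context {V : normedModType R} {p q : nat}.

Lemma locally_unif_limit_is_diff (f : T -> V -> 'M[R]_(p, q))
    (g : V -> 'M[R]_(p, q)) (x : V) (dg : {linear V -> 'M[R]_(p, q)}) :
  continuous dg ->
  (\forall y \near x & t \near F, differentiable (f t) y) ->
  (\forall y \near x, f ^~ y @ F --> g y) ->
  (forall e, 0 < e -> \forall y \near x & t \near F,
     forall h, `|'D_h (f t) y - dg h| <= e * `|h|) ->
  is_diff x g dg.
Proof.
move=> cdg df fg dfg; apply/is_diff_normP => // e e0.
have [[A B] /= [nA FB] AB] := filterI df (dfg _ e0).
have /nbhs_ballP[r /= r0 rA] : nbhs x (A `&` [set y | f ^~ y @ F --> g y]).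
  exact: filterI.
near=> h.
have hr : `|h| < r by near: h; exact: nbhs0_lt.
have xth t : 0 <= t <= 1 -> ball x r (x + t *: h).
  move=> /andP[t0 t1]; rewrite -ball_normE/= opprD addrA subrr sub0r normrN.
  by rewrite normrZ ger0_norm// (le_lt_trans _ hr)// ler_piMl.
have fh t : B t -> `|f t (x + h) - f t x - dg h| <= e * `|h|.
  move=> Bt; apply: mean_value_le => [|s s01|s s01].
  - by rewrite mulr_ge0// ltW.
  - by have [] := AB (x + s *: h, t) (conj (rA _ (xth _ s01)).1 Bt).
  - by have [_] := AB (x + s *: h, t) (conj (rA _ (xth _ s01)).1 Bt); exact.
have fgx : f ^~ x @ F --> g x by exact: (nbhs_singleton fg).
have fgxh : f ^~ (x + h) @ F --> g (x + h).
  by have := (rA _ (xth 1 _)).2; rewrite scale1r; apply; rewrite ler01 lexx.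
have fL : `|f t (x + h) - f t x - dg h| @[t --> F] -->
    `|g (x + h) - g x - dg h|.
  by apply: cvg_norm; apply: cvgB; [exact: cvgB|exact: cvg_cst].
rewrite [h + x]addrC; apply: (closed_cvg _ (@closed_le _ (e * `|h|)) _ _ fL).
exact: filterS FB.
Unshelve. all: by end_near. Qed.

End LocallyUniformLimits.

Section PartialDerivatives.
Context {R : realType} {n : nat}.

Definition row_comb {W : normedModType R} (w : 'I_n -> W) (v : 'rV[R]_n) : W :=
  \sum_i v 0 i *: w i.

Fact row_comb_is_linear {W : normedModType R} (w : 'I_n -> W) :
  linear (row_comb w).
Proof.
move=> a u v; rewrite /row_comb scaler_sumr -big_split/=; apply: eq_bigr => i _.
by rewrite !mxE scalerDl scalerA.
Qed.

HB.instance Definition _ (W : normedModType R) (w : 'I_n -> W) :=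
  GRing.isLinear.Build R 'rV[R]_n W _ (row_comb w) (row_comb_is_linear w).

Lemma row_comb_continuous (W : normedModType R) (w : 'I_n -> W) :
  continuous (row_comb w).
Proof.
apply: (@continuous_big W _ +%R 0 xpredT _ 'rV[R]_n) => [|i _ v].
  exact: add_continuous.
apply: (@cvgZ _ _ _ (nbhs v) _ (fun v : 'rV[R]_n => v 0 i) (fun=> w i)).
  exact: coord_continuous.
exact: cvg_cst.
Qed.

Lemma row_comb_delta (W : normedModType R) (w : 'I_n -> W) i :
  row_comb w (delta_mx 0 i) = w i.
Proof.
rewrite /row_comb (bigD1 i)//= mxE !eqxx scale1r big1 ?addr0// => j ji.
by rewrite mxE (negPf ji) andbF scale0r.
Qed.

Lemma derive_partials (W : normedModType R) (f : 'rV[R]_n -> W) x v :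
  differentiable f x -> 'D_v f x = row_comb (fun i => 'D_(delta_mx 0 i) f x) v.
Proof.
move=> df; rewrite deriveE// {1}(row_sum_delta v) linear_sum.
by apply: eq_bigr => i _; rewrite linearZ deriveE.
Qed.

Lemma norm_row_comb_le (W : normedModType R) (w : 'I_n -> W) v d :
  (forall i, `|w i| <= d) -> `|row_comb w v| <= n%:R * d * `|v|.
Proof.
move=> wd; apply: le_trans (ler_norm_sum _ _ _) _.
rewrite -mulrA mulr_natl -[X in _ *+ X]card_ord -sumr_const ler_sum// => i _.
by rewrite normrZ mulrC ler_pM// le_mx_norm.
Qed.

Lemma locally_unif_limit_is_diff_partials {p q : nat} {T : Type}
    {F : set_system T} {FF : ProperFilter F}
    (f : T -> 'rV[R]_n -> 'M[R]_(p, q)) (g : 'rV[R]_n -> 'M[R]_(p, q))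
    (dg : 'I_n -> 'rV[R]_n -> 'M[R]_(p, q)) (x : 'rV[R]_n) :
  (\forall y \near x & t \near F, differentiable (f t) y) ->
  (forall i t, {for x, continuous ('D_(delta_mx 0 i) (f t))}) ->
  (\forall y \near x, f ^~ y @ F --> g y) ->
  (forall i, locally_unif_cvg F (fun t => 'D_(delta_mx 0 i) (f t)) (dg i) x) ->
  is_diff x g (row_comb (dg ^~ x)).
Proof.
move=> df cdf fg dfg; apply: locally_unif_limit_is_diff (df) fg _.
  exact: row_comb_continuous.
move=> e e0; pose d := e / n.+1%:R; have d0 : 0 < d by rewrite divr_gt0.
have cdg i : {for x, continuous (dg i)}.
  exact: locally_unif_limit_continuous (cdf i) (dfg i).
have dgd : \forall y \near x & t \near F,
    forall i, `|dg i x - 'D_(delta_mx 0 i) (f t) y| < d.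
  have FP : Filter (filter_prod (nbhs x) F) by exact: filter_prod_filter.
  pose near_dg i (z : 'rV[R]_n * T) :=
    `|dg i x - 'D_(delta_mx 0 i) (f z.2) z.1| < d.
  apply: (@filter_forall _ _ near_dg _ FP) => i.
  exact: locally_unif_cvg_cst (cdg i) (dfg i) _ d0.
apply: filterS2 df dgd => -[y t] /= dft dgd h.
rewrite (derive_partials _ dft) distrC -sumrB.
under eq_bigr do rewrite -scalerBr.
apply: le_trans (norm_row_comb_le _ (fun i => ltW (dgd i))) _.
rewrite ler_wpM2r// /d mulrCA ler_piMr ?(ltW e0)//.
by rewrite ler_pdivrMr// mul1r ler_nat.
Qed.

End PartialDerivatives.

Section SmoothMaps.
Context {R : realType} {n : nat}.
Variables (O : set 'rV[R]_n) (oO : open O).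

Let near_eqO {W : normedModType R} (f g : 'rV[R]_n -> W) x :
  O x -> (forall y, O y -> f y = g y) -> \near x, f x = g x.
Proof. by move=> Ox fg; apply: filterS (open_nbhs_nbhs (conj oO Ox)). Qed.

Section Linearity.
Context {W : normedModType R}.
Implicit Types f g : 'rV[R]_n -> W.

Lemma eq_derive_open f g v x : O x -> (forall y, O y -> f y = g y) ->
  'D_v f x = 'D_v g x.
Proof. by move=> Ox fg; exact/near_eq_derive/near_eqO. Qed.

Lemma eq_iter_partial f g s : (forall x, O x -> f x = g x) ->
  forall x, O x -> iter_partial s f x = iter_partial s g x.
Proof. by move=> fg; elim: s => //= i s IH x Ox; exact: eq_derive_open. Qed.

Lemma eq_Ck k f g : (forall x, O x -> f x = g x) -> Ck k O f -> Ck k O g.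
Proof.
elim: k f g => [|k IH] f g fg /=.
  by apply: subspace_eq_continuous => x; rewrite inE => Ox; exact: fg.
move=> [df Df]; split=> [x Ox|v].
  by apply: near_eq_differentiable (df x Ox); exact: near_eqO.
by apply: IH (Df v) => x Ox; exact: eq_derive_open.
Qed.

Lemma eq_smooth f g : (forall x, O x -> f x = g x) ->
  smooth_on O f -> smooth_on O g.
Proof. by move=> fg fs k; exact: eq_Ck fg (fs k). Qed.

Lemma Ck0 k : Ck k O (fun=> 0 : W).
Proof.
elim: k => [|k IH] /=; first by move=> x; exact: cvg_cst.
split=> [x _|v]; first exact: differentiable_cst.
by apply: eq_Ck IH => x _; rewrite derive_cst.
Qed.

Lemma Ck_lincomb k a f g : Ck k O f -> Ck k O g -> Ck k O (a *: f + g).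
Proof.
elim: k f g => [|k IH] f g /=.
  rewrite !continuous_open_subspace// => cf cg x Ox.
  apply: (@cvgD _ _ _ _ _ (a *: f) g _ _ _ (cg x Ox)).
  exact: cvgZ (cvg_cst _) (cf x Ox).
move=> [df Df] [dg Dg]; split=> [x Ox|v].
  exact/differentiableD/(dg x Ox)/differentiableZ/(df x Ox).
apply: eq_Ck (IH _ _ (Df v) (Dg v)) => x Ox.
rewrite deriveD ?deriveZ//; last exact/diff_derivable/(dg x Ox).
  exact/diff_derivable/(df x Ox).
exact/derivableZ/diff_derivable/(df x Ox).
Qed.

Lemma Ck_sum k I (r : seq I) (a : I -> R) (f : I -> 'rV[R]_n -> W) :
  (forall i, Ck k O (f i)) -> Ck k O (fun x => \sum_(i <- r) a i *: f i x).
Proof.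
move=> fk; elim: r => [|i r IH].
  by apply: eq_Ck (Ck0 k) => x _; rewrite big_nil.
by apply: eq_Ck (Ck_lincomb (a i) (fk i) IH) => x _; rewrite big_cons.
Qed.

Lemma smooth0 : smooth_on O (fun=> 0 : W).
Proof. by move=> k; exact: Ck0. Qed.

Lemma smooth_lincomb a f g : smooth_on O f -> smooth_on O g ->
  smooth_on O (a *: f + g).
Proof. by move=> fs gs k; exact: Ck_lincomb. Qed.

Lemma smooth_differentiable f x : smooth_on O f -> O x -> differentiable f x.
Proof. by move=> /(_ 1%N)[+ _]; exact. Qed.

Lemma smooth_continuous f x : smooth_on O f -> O x -> {for x, continuous f}.
Proof.
by move=> fs Ox; exact/differentiable_continuous/smooth_differentiable.
Qed.

Lemma smooth_derivable f x v : smooth_on O f -> O x -> derivable f x v.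
Proof. by move=> fs Ox; exact/diff_derivable/smooth_differentiable. Qed.

Lemma smooth_derive f v : smooth_on O f -> smooth_on O ('D_v f).
Proof. by move=> fs k; exact: (fs k.+1).2. Qed.

Lemma smooth_iter_partial f s : smooth_on O f -> smooth_on O (iter_partial s f).
Proof. by move=> fs; elim: s => //= i s; exact: smooth_derive. Qed.

Lemma iter_partial_lincomb a f g s : smooth_on O f -> smooth_on O g ->
  forall x, O x -> iter_partial s (a *: f + g) x =
    a *: iter_partial s f x + iter_partial s g x.
Proof.
move=> fs gs; elim: s => //= i s IH x Ox.
rewrite (eq_derive_open
  (g := a *: iter_partial s f + iter_partial s g) _ Ox IH).
have df := @smooth_derivable _ x (delta_mx 0 i) (smooth_iter_partial s fs) Ox.
have dg := @smooth_derivable _ x (delta_mx 0 i) (smooth_iter_partial s gs) Ox.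
by rewrite deriveD ?deriveZ//; exact: derivableZ.
Qed.

End Linearity.

Lemma Ck_entry {p q : nat} k (f : 'rV[R]_n -> 'M[R]_(p, q)) a b :
  Ck k O f -> Ck k O (fun x => f x a b : R).
Proof.
elim: k f => [|k IH] f /=.
  rewrite !continuous_open_subspace// => cf x Ox.
  apply: (@continuous_comp _ _ _ f (fun A => A a b)); first exact: cf.
  exact: coord_continuous.
move=> [df Df]; split=> [x Ox|v].
  apply: (@differentiable_comp _ _ _ _ f (fun A => A a b)); first exact: df.
  exact: differentiable_coord.
apply: eq_Ck (IH _ (Df v)) => x Ox.
by rewrite derive_mx ?mxE//; exact/diff_derivable/df.
Qed.

Lemma smooth_entry {p q : nat} (f : 'rV[R]_n -> 'M[R]_(p, q)) a b :
  smooth_on O f -> smooth_on O (fun x => f x a b : R).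
Proof. by move=> fs k; exact: Ck_entry. Qed.

End SmoothMaps.

Lemma compact_nbhs_in_open {R : realType} {n : nat} (O : set 'rV[R]_n) x :
  open O -> O x -> exists K, [/\ compact K, K `<=` O & nbhs x K].
Proof.
move=> oO Ox.
have /nbhs_closedballP[r rO] : nbhs x O by exact: open_nbhs_nbhs.
exists (closed_ball x r%:num); split=> //; last first.
  by apply/nbhs_closedballP; exists r.
apply: bounded_closed_compact; last exact: closed_ball_closed.
exists (`|x| + r%:num); split=> [|c rc y]; first exact: num_real.
rewrite closed_ballE// => xy; rewrite /= (le_trans _ (ltW rc))//.
by rewrite -[y](subKr x) (le_trans (ler_normB _ _))// lerD2l.
Qed.

Definition unif_close {R : realType} {X : Type} {W : normedModType R}
    (K : set X) (e : R) (f g : X -> W) : Prop :=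
  forall x, K x -> `|f x - g x| < e.

Definition cauchy_partials {R : realType} {n : nat} {W : normedModType R}
    (O : set 'rV[R]_n) (f : nat -> 'rV[R]_n -> W) : Prop :=
  forall s K, compact K -> K `<=` O -> forall e : R, 0 < e ->
  exists N, forall k l, (N <= k)%N -> (N <= l)%N ->
    unif_close K e (iter_partial s (f k)) (iter_partial s (f l)).

Section SmoothLimit.
Context {R : realType} {n p q : nat} (O : set 'rV[R]_n).
Variable f : nat -> 'rV[R]_n -> 'M[R]_(p, q).
Hypotheses (oO : open O) (f_smooth : forall k, smooth_on O (f k)).
Hypothesis f_cauchy : cauchy_partials O f.

Definition limit_partial s (x : 'rV[R]_n) : 'M[R]_(p, q) :=
  lim (iter_partial s (f k) x @[k --> \oo]).

Lemma limit_partial_cvg s x : O x ->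
  iter_partial s (f k) x @[k --> \oo] --> limit_partial s x.
Proof.
move=> Ox; apply/cauchy_cvgP/cauchy_exP => e e0.
have [|N fN] := f_cauchy s (@compact_set1 _ x) _ e0; first by move=> _ ->.
exists (iter_partial s (f N) x); exists N => // k /= Nk.
by rewrite -ball_normE; exact: fN.
Qed.

Lemma limit_partial_unif s K e : compact K -> K `<=` O -> 0 < e ->
  \forall k \near \oo, unif_close K e (limit_partial s) (iter_partial s (f k)).
Proof.
move=> cK KO e0; have e20 : 0 < e / 2 by rewrite divr_gt0.
have [N fN] := f_cauchy s cK KO e20; exists N => // k /= Nk x Kx.
have lN : \forall l \near \oo, (N <= l)%N by exists N.
have /cvgrPdist_lt/(_ _ e20) lx := @limit_partial_cvg s _ (KO _ Kx).
have [l [{}Nl {}lx]] := filter_ex (filterI lN lx).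
rewrite -(subrKA (iter_partial s (f l) x)) [ltRHS]splitr.
by rewrite (le_lt_trans (ler_normD _ _))// ltrD//; exact: fN.
Qed.

Lemma limit_partial_locally_unif_cvg s x : O x ->
  locally_unif_cvg \oo (fun k => iter_partial s (f k)) (limit_partial s) x.
Proof.
move=> Ox e e0; have [K [cK KO xK]] := compact_nbhs_in_open oO Ox.
exists (K, [set k | unif_close K e (limit_partial s) (iter_partial s (f k))]).
  by split=> //; exact: limit_partial_unif.
by move=> [y k] /= [Ky /(_ y Ky)].
Qed.

Lemma limit_partial_is_diff s x : O x ->
  is_diff x (limit_partial s) (row_comb (fun i => limit_partial (i :: s) x)).
Proof.
move=> Ox; have nO : nbhs x O by exact: open_nbhs_nbhs.
apply: (@locally_unif_limit_is_diff_partials _ _ _ _ _ \oo _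
  (fun k => iter_partial s (f k)) _ (fun i => limit_partial (i :: s))).
- exists (O, setT); first by split=> //; exact: filterT.
  move=> [y k] [/= Oy _].
  exact/(smooth_differentiable _ Oy)/smooth_iter_partial.
- move=> i k.
  exact: (smooth_continuous (smooth_iter_partial (i :: s) (f_smooth k))).
- by apply: filterS nO => y; exact: limit_partial_cvg.
- by move=> i; exact: limit_partial_locally_unif_cvg.
Qed.

Lemma limit_partial_derive s v x : O x ->
  'D_v (limit_partial s) x = row_comb (fun i => limit_partial (i :: s) x) v.
Proof. by move=> /(limit_partial_is_diff s)[ds dsE]; rewrite deriveE// dsE. Qed.

Lemma smooth_limit_partial s : smooth_on O (limit_partial s).
Proof.
move=> k; elim: k s => [|k IH] s /=.
  rewrite continuous_open_subspace// => x; rewrite inE => Ox.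
  by apply/differentiable_continuous; case: (limit_partial_is_diff s Ox).
split=> [x Ox|v]; first by case: (limit_partial_is_diff s Ox).
apply: eq_Ck (Ck_sum oO _ (v 0) (fun i => IH (i :: s))) => // x Ox.
exact/esym/(limit_partial_derive _ _ Ox).
Qed.

Lemma iter_partial_limit s x : O x ->
  iter_partial s (limit_partial [::]) x = limit_partial s x.
Proof.
elim: s x => //= i s IH x Ox.
by rewrite (eq_derive_open oO _ Ox IH) limit_partial_derive// row_comb_delta.
Qed.

End SmoothLimit.

Definition jet_le {R : realType} {m : nat} {W : normedModType R} k (e : R)
    (f : 'rV[R]_m -> W) y : Prop :=
  forall t, (size t <= k)%N -> `|iter_partial t f y| <= e.

Section DifferentialOperators.
Context {R : realType} {n m p q : nat}.
Variables (O : set 'rV[R]_n) (O' : set 'rV[R]_m) (phi : 'rV[R]_n -> 'rV[R]_m).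
Hypotheses (oO : open O) (phi_smooth : smooth_on O phi).
Hypothesis phiO : forall x, O x -> O' (phi x).
Implicit Types f : 'rV[R]_m -> 'M[R]_(p, q).
Implicit Types T : ('rV[R]_m -> 'M[R]_(p, q)) -> 'rV[R]_n -> R.

(* The operators f |-> \sum_t c_t * (iter_partial t f \o phi) of order at most k
   with smooth coefficients c_t. Multiplication by a smooth function is a
   constructor, so that stability under partial derivatives is an induction and
   no product of smooth functions is ever formed. *)
Inductive diff_op :
    nat -> (('rV[R]_m -> 'M[R]_(p, q)) -> 'rV[R]_n -> R) -> Prop :=
| diff_op_partial k t a b of (size t <= k)%N :
    diff_op k (fun f x => iter_partial t f (phi x) a b)
| diff_op0 k : diff_op k (fun _ _ => 0)
| diff_opD k T T' of diff_op k T & diff_op k T' :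
    diff_op k (fun f x => T f x + T' f x)
| diff_opM k (c : 'rV[R]_n -> R) T of smooth_on O c & diff_op k T :
    diff_op k (fun f x => c x * T f x)
| eq_diff_op k T T' of
    (forall f x, smooth_on O' f -> O x -> T f x = T' f x) & diff_op k T :
    diff_op k T'.

Lemma diff_op_sum k I (r : seq I) (T : I -> _ -> _ -> R) :
  (forall i, diff_op k (T i)) -> diff_op k (fun f x => \sum_(i <- r) T i f x).
Proof.
move=> kT; elim: r => [|i r IH].
  by apply: eq_diff_op (diff_op0 k) => f x _ _; rewrite big_nil.
by apply: eq_diff_op (diff_opD (kT i) IH) => f x _ _; rewrite big_cons.
Qed.

Lemma diff_opS k T : diff_op k T -> diff_op k.+1 T.
Proof.
elim=> {k T} [k t a b tk|k|k T T' _ IH _ IH'|k c T cs _ IH|k T T' TT' _ IH].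
- by apply: diff_op_partial; exact: leqW.
- exact: diff_op0.
- exact: diff_opD.
- exact: diff_opM.
- exact: eq_diff_op IH.
Qed.

Lemma differentiable_partial_comp f t x : smooth_on O' f -> O x ->
  differentiable (iter_partial t f \o phi) x.
Proof.
move=> fs Ox; apply: differentiable_comp.
  exact: smooth_differentiable Ox.
exact/(smooth_differentiable _ (phiO Ox))/smooth_iter_partial.
Qed.

Lemma derive_partial_comp f t v x : smooth_on O' f -> O x ->
  'D_v (iter_partial t f \o phi) x =
  row_comb (fun c => iter_partial (c :: t) f (phi x)) ('D_v phi x).
Proof.
move=> fs Ox.
have dphi : differentiable phi x by exact: smooth_differentiable Ox.
have df : differentiable (iter_partial t f) (phi x).
  exact/(smooth_differentiable _ (phiO Ox))/smooth_iter_partial.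
rewrite deriveE; last exact: differentiable_partial_comp.
by rewrite diff_comp//= -!deriveE// (derive_partials _ df).
Qed.

Lemma diff_op_differentiable k T f x : diff_op k T -> smooth_on O' f -> O x ->
  differentiable (T f) x.
Proof.
move=> kT fs Ox.
elim: kT => {k T}
  [k t a b tk|k|k T T' _ IH _ IH'|k c T cs _ IH|k T T' TT' _ IH].
- apply: (@differentiable_comp _ _ _ _ (iter_partial t f \o phi)
    (fun A => A a b)).
    exact: differentiable_partial_comp.
  exact: differentiable_coord.
- exact: differentiable_cst.
- exact: (@differentiableD _ _ _ (T f) (T' f)).
- exact: (@differentiableM _ _ c (T f) _ (smooth_differentiable cs Ox)).
- apply: near_eq_differentiable IH.
  by apply: filterS (open_nbhs_nbhs (conj oO Ox)) => y; exact: TT'.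
Qed.

Lemma smooth_derive_entry v i : smooth_on O (fun x => 'D_v phi x 0 i : R).
Proof. exact/(smooth_entry oO)/smooth_derive. Qed.

Lemma diff_op_derive k T v : diff_op k T ->
  diff_op k.+1 (fun f x => 'D_v (T f) x).
Proof.
elim=> {k T}
  [k t a b tk|k|k T T' kT IH kT' IH'|k c T cs kT IH|k T T' TT' kT IH].
- apply: (@eq_diff_op _ (fun f x => \sum_c
      'D_v phi x 0 c * iter_partial (c :: t) f (phi x) a b)); last first.
    apply: diff_op_sum => c; apply: diff_opM; first exact: smooth_derive_entry.
    exact: diff_op_partial.
  move=> f x fs Ox; have df := differentiable_partial_comp t fs Ox.
  transitivity ('D_v (iter_partial t f \o phi) x a b); last first.
    by rewrite derive_mx ?mxE//; exact: diff_derivable.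
  rewrite derive_partial_comp// /row_comb summxE.
  by apply: eq_bigr => c _; rewrite mxE.
- by apply: eq_diff_op (diff_op0 _) => f x _ _; rewrite derive_cst.
- apply: eq_diff_op (diff_opD IH IH') => f x fs Ox.
  rewrite -[RHS]/('D_v (T f + T' f) x) deriveD//; apply: diff_derivable.
  + exact: diff_op_differentiable kT fs Ox.
  + exact: diff_op_differentiable kT' fs Ox.
- apply: eq_diff_op (diff_opD (diff_opM cs IH)
    (diff_opM (smooth_derive v cs) (diff_opS kT))) => f x fs Ox.
  rewrite -[RHS]/('D_v (c * T f) x) deriveM//=.
  + by rewrite [T f x *: _]mulrC.
  + exact: smooth_derivable cs Ox.
  + exact/diff_derivable/(diff_op_differentiable kT fs Ox).
- apply: eq_diff_op IH => f x fs Ox; apply: (eq_derive_open oO) Ox _ => y.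
  exact: TT'.
Qed.

Lemma diff_op_bound k T x0 : diff_op k T -> O x0 ->
  exists C : R, \forall x \near x0, forall f e, smooth_on O' f ->
    jet_le k e f (phi x) -> `|T f x| <= C * e.
Proof.
move=> kT Ox0.
elim: kT => {k T} [k t a b tk|k|k T T' _ [C TC] _ [C' TC']|k c T cs _ [C TC]|].
- exists 1; apply: (@filterE _ (nbhs x0)) => x f e _ fe.
  by rewrite mul1r (le_trans (le_mx_norm _ _ _))// fe.
- by exists 0; apply: (@filterE _ (nbhs x0)) => x f e _ _; rewrite normr0 mul0r.
- exists (C + C'); apply: filterS2 TC TC' => x TC TC' f e fs fe.
  by rewrite mulrDl (le_trans (ler_normD _ _))// lerD ?TC ?TC'.
- exists ((`|c x0| + 1) * C).
  have cx := continuous_near_dist_lt (smooth_continuous cs Ox0) ltr01.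
  apply: filterS2 TC cx => x TC cx f e fs fe.
  rewrite normrM -mulrA ler_pM// ?TC//.
  rewrite -[c x](subKr (c x0)) (le_trans (ler_normB _ _))//.
  by rewrite lerD2l ltW.
- move=> k T T' TT' _ [C TC]; exists C.
  apply: filterS2 TC (open_nbhs_nbhs (conj oO Ox0)) => x TC Ox f e fs fe.
  by rewrite -TT'// TC.
Qed.

Definition diff_op_mx {r c : nat} k (G : _ -> _ -> 'M[R]_(r, c)) : Prop :=
  forall a b, diff_op k (fun f x => G f x a b).

Lemma diff_op_mx_derivable {r c : nat} k (G : _ -> _ -> 'M[R]_(r, c)) f x v :
  diff_op_mx k G -> smooth_on O' f -> O x -> derivable (G f) x v.
Proof.
move=> kG fs Ox; apply/derivable_mxP => a b.
exact/diff_derivable/(diff_op_differentiable (kG a b) fs Ox).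
Qed.

Lemma diff_op_mx_iter_partial {r c : nat} k (G : _ -> _ -> 'M[R]_(r, c)) s :
  diff_op_mx k G -> diff_op_mx (size s + k) (fun f => iter_partial s (G f)).
Proof.
move=> kG; elim: s => //= i s IH a b; rewrite addSn.
apply: eq_diff_op (diff_op_derive (delta_mx 0 i) (IH a b)) => f x fs Ox.
by rewrite derive_mx ?mxE//; exact: diff_op_mx_derivable IH fs Ox.
Qed.

Lemma diff_op_mx_bound {r c : nat} k (G : _ -> _ -> 'M[R]_(r, c)) x0 :
  diff_op_mx k G -> O x0 ->
  exists C : R, \forall x \near x0, forall f e, smooth_on O' f ->
    jet_le k e f (phi x) -> `|G f x| <= C * e.
Proof.
move=> kG Ox0.
pose bounded (C : R) (ab : 'I_r * 'I_c) x := forall f e, smooth_on O' f ->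
  jet_le k e f (phi x) -> `|G f x ab.1 ab.2| <= C * e.
have /choice[C GC] : forall ab, exists C, \forall x \near x0, bounded C ab x.
  by move=> ab; exact: diff_op_bound (kG ab.1 ab.2) Ox0.
exists (\sum_ab `|C ab|).
have := @filter_forall _ _ (fun ab => bounded (C ab) ab) _ (nbhs_filter x0) GC.
apply: filterS => x {}GC f e fs fe.
have e0 : 0 <= e := le_trans (normr_ge0 _) (fe [::] isT).
apply: mx_norm_le => [|a b]; first by rewrite mulr_ge0// sumr_ge0.
apply: le_trans (GC (a, b) f e fs fe) _; rewrite ler_wpM2r//.
by rewrite (bigD1 (a, b))//= (le_trans (ler_norm _))// lerDl sumr_ge0.
Qed.

End DifferentialOperators.

Section Pullback.
Context {R : realType} {n m : nat}.

Definition pullback (phi : 'rV[R]_n -> 'rV[R]_m) (f : 'rV[R]_m -> 'M[R]_m)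
    (x : 'rV[R]_n) : 'M[R]_n :=
  'J phi x *m f (phi x) *m ('J phi x)^T.

Variables (O : set 'rV[R]_n) (O' : set 'rV[R]_m) (phi : 'rV[R]_n -> 'rV[R]_m).
Hypotheses (oO : open O) (phi_smooth : smooth_on O phi).
Hypothesis phiO : forall x, O x -> O' (phi x).

Lemma diff_op_mx_pullback : diff_op_mx O O' phi 0 (@pullback phi).
Proof.
move=> a b.
have jacobianE x c i : O x -> 'J phi x c i = 'D_(delta_mx 0 c) phi x 0 i.
  move=> Ox; rewrite deriveEjacobian -?rowE ?[row _ _ _ _]mxE//.
  exact: smooth_differentiable Ox.
apply: (@eq_diff_op _ _ _ _ _ _ _ _ _ (fun f x =>
    \sum_j 'D_(delta_mx 0 b) phi x 0 j *
      \sum_i 'D_(delta_mx 0 a) phi x 0 i * f (phi x) i j)).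
  move=> f x _ Ox; rewrite mxE; apply: eq_bigr => j _.
  rewrite [_^T _ _]mxE jacobianE// mulrC [(_ *m _) _ _]mxE; congr (_ * _).
  by apply: eq_bigr => i _; rewrite jacobianE.
do 2![apply: diff_op_sum => ?; apply: diff_opM;
  first exact: smooth_derive_entry].
exact: (@diff_op_partial _ _ _ _ _ _ _ _ _ [::]).
Qed.

Lemma iter_partial_pullback_bound s x0 : O x0 ->
  exists C : R, \forall x \near x0, forall f e, smooth_on O' f ->
    jet_le (size s) e f (phi x) ->
    `|iter_partial s (pullback phi f) x| <= C * e.
Proof.
move=> Ox0.
have := diff_op_mx_iter_partial oO phi_smooth phiO s diff_op_mx_pullback.
by rewrite addn0 => /diff_op_mx_bound; exact.
Qed.

End Pullback.

Section TruncatedSup.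
Context {R : realType} {V : lmodType R} {I : Type}.
Variables (D : set I) (order : I -> nat) (p : I -> V -> R).
Hypothesis pZ : forall i a v, D i -> p i (a *: v) = `|a| * p i v.
Hypothesis pD : forall i v w, D i -> p i (v + w) <= p i v + p i w.
Implicit Types (i : I) (v w : V) (k : nat).

(* Truncating every seminorm at a level that tends to 0 with its order and
   taking a supremum, instead of summing a series, makes all balls absolutely
   convex. *)
Definition truncated_sup v : R :=
  sup [set Num.min (order i).+1%:R^-1 (p i v) | i in D].

Definition seminorm_ball k (e : R) : set V :=
  [set v | forall i, D i -> (order i <= k)%N -> p i v < e].

Let p_ge0 i v : D i -> 0 <= p i v.
Proof.
move=> Di; have := pD v (- v) Di.
rewrite subrr -[X in p i X](scale0r v) -scaleN1r.
by rewrite !pZ// normr0 mul0r normrN1 mul1r -mulr2n pmulrn_lge0.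
Qed.

Lemma truncated_sup_le v r : 0 <= r ->
  (forall i, D i -> Num.min (order i).+1%:R^-1 (p i v) <= r) ->
  truncated_sup v <= r.
Proof.
move=> r0 pr; rewrite /truncated_sup.
have [->|/set0P D0] := eqVneq D set0; first by rewrite image_set0 sup0.
apply: ge_sup => [|_ [j Dj <-]]; last exact: pr.
exact: image_nonempty.
Qed.

Lemma le_truncated_sup v i : D i ->
  Num.min (order i).+1%:R^-1 (p i v) <= truncated_sup v.
Proof.
move=> Di; apply: ub_le_sup; last by exists i.
by exists 1 => _ [j _ <-]; rewrite ge_min invf_le1// ler1n.
Qed.

Lemma truncated_sup_ge0 v : 0 <= truncated_sup v.
Proof.
have [D0|/set0P[i Di]] := eqVneq D set0.
  by rewrite /truncated_sup D0 image_set0 sup0.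
by apply: le_trans (le_truncated_sup v Di); rewrite le_min invr_ge0 ler0n p_ge0.
Qed.

Lemma truncated_sup_eq0 v i : truncated_sup v = 0 -> D i -> p i v = 0.
Proof.
move=> v0 Di; apply/le_anti; rewrite p_ge0// andbT.
by have := le_truncated_sup v Di; rewrite v0 ge_min leNgt invr_gt0 ltr0n.
Qed.

Lemma truncated_sup0 : truncated_sup 0 = 0.
Proof.
apply/le_anti; rewrite truncated_sup_ge0 andbT.
apply: truncated_sup_le => // i Di.
by rewrite ge_min -(scale0r (0 : V)) pZ// normr0 mul0r lexx orbT.
Qed.

Lemma truncated_sup_conv (a b : R) v w : `|a| + `|b| <= 1 ->
  truncated_sup (a *: v + b *: w) <=
    Num.max (truncated_sup v) (truncated_sup w).
Proof.
move=> ab; apply: truncated_sup_le => [|i Di].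
  by rewrite le_max truncated_sup_ge0.
set m := Num.max (p i v) (p i w).
apply: (@le_trans _ _ (Num.min (order i).+1%:R^-1 m)); last first.
  rewrite min_maxr ge_max !le_max.
  by rewrite (le_truncated_sup v Di) (le_truncated_sup w Di) orbT.
rewrite le_min ge_min lexx/= ge_min; apply/orP; right.
rewrite (le_trans (pD _ _ Di))// !pZ// (@le_trans _ _ ((`|a| + `|b|) * m))//.
  by rewrite mulrDl lerD// ler_wpM2l// le_max lexx ?orbT.
by rewrite ler_piMl// le_max p_ge0.
Qed.

Lemma truncated_supN v : truncated_sup (- v) = truncated_sup v.
Proof.
have supN w : truncated_sup (- w) <= truncated_sup w.
  have := @truncated_sup_conv (-1) 0 w w.
  by rewrite scaleN1r scale0r addr0 maxxx normrN1 normr0 addr0; exact.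
by apply/le_anti; rewrite supN -{1}[v]opprK supN.
Qed.

Lemma truncated_supD v w :
  truncated_sup (v + w) <= truncated_sup v + truncated_sup w.
Proof.
apply: truncated_sup_le => [|i Di].
  by rewrite addr_ge0 ?truncated_sup_ge0.
apply: le_trans (lerD (le_truncated_sup v Di) (le_truncated_sup w Di)).
have := pD v w Di; have := p_ge0 v Di; have := p_ge0 w Di.
have : 0 <= (order i).+1%:R^-1 :> R by rewrite invr_ge0.
move: _^-1 (p i v) (p i w) (p i (v + w)) => c x y z c0 y0 x0 zxy.
by rewrite ge_min; have [|] := leP c x; have [|] := leP c y; lra.
Qed.

Lemma truncated_sup_lt_seminorm_ball k e : 0 < e -> exists2 d : R, 0 < d &
  forall v, truncated_sup v < d -> seminorm_ball k e v.
Proof.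
move=> e0; exists (Num.min k.+1%:R^-1 e).
  by rewrite lt_min invr_gt0 ltr0n.
move=> v; rewrite lt_min => /andP[vk ve] i Di ik.
have := le_truncated_sup v Di.
rewrite ge_min => /orP[|/le_lt_trans]; last exact.
move=> /le_lt_trans/(_ vk); rewrite ltf_pV2 ?posrE// ltr_nat ltnS ltnNge.
by rewrite ik.
Qed.

Lemma seminorm_ball_truncated_sup_lt d : 0 < d ->
  exists k, exists2 e : R, 0 < e &
    forall v, seminorm_ball k e v -> truncated_sup v < d.
Proof.
move=> d0; have d20 : 0 < d / 2 by rewrite divr_gt0.
have /filter_ex[k kd] := near_infty_natSinv_lt (PosNum d20).
exists k, (d / 2) => // v vk; apply: (@le_lt_trans _ _ (d / 2)); last by lra.
apply: truncated_sup_le => [|i Di]; first exact: ltW.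
rewrite ge_min; have [ik|ki] := leqP (order i) k; apply/orP; [right|left].
  exact/ltW/vk.
by rewrite (le_trans _ (ltW kd))// lef_pV2 ?posrE// ler_nat leqW.
Qed.

End TruncatedSup.

Section SeminormFrechet.
Context {R : realType} {E : topologicalLmodType R} {I : Type}.
Variables (D : set I) (order : I -> nat) (p : I -> E -> R).
Hypothesis pZ : forall i a v, D i -> p i (a *: v) = `|a| * p i v.
Hypothesis pD : forall i v w, D i -> p i (v + w) <= p i v + p i w.
Hypothesis p_separating : forall v, (forall i, D i -> p i v = 0) -> v = 0.
Hypothesis nbhs_seminorm : forall v (U : set E), nbhs v U <->
  exists k, exists2 e, 0 < e &
    forall w, seminorm_ball D order p k e (v - w) -> U w.
Hypothesis seminorm_complete : forall u : nat -> E,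
  (forall k e, 0 < e -> exists N, forall l m, (N <= l)%N -> (N <= m)%N ->
     seminorm_ball D order p k e (u l - u m)) ->
  exists v : E, u @ \oo --> v.

Let dist (v w : E) : R := truncated_sup D order p (v - w).

Let distxx v : dist v v = 0.
Proof. by rewrite /dist subrr truncated_sup0. Qed.

Let dist_eq v w : dist v w = 0 -> v = w.
Proof.
by move=> vw; apply/subr0_eq/p_separating => i; exact: truncated_sup_eq0 vw.
Qed.

Let dist_sym v w : dist v w = dist w v.
Proof. by rewrite /dist -truncated_supN// opprB. Qed.

Let dist_triangle w v u : dist v u <= dist v w + dist w u.
Proof. by rewrite /dist -(subrKA w) truncated_supD. Qed.

Let distD2r u v w : dist (v + u) (w + u) = dist v w.
Proof. by rewrite /dist opprD addrACA subrr addr0. Qed.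

Let dist_ball_convex (r : R) : absolutely_convex [set v | dist v 0 < r].
Proof.
move=> a b v w ab /=; rewrite /dist !subr0 => vr wr.
by rewrite (le_lt_trans (truncated_sup_conv order pZ pD _ _ ab))// gt_max vr.
Qed.

Let nbhs_dist v : nbhs v =
  filter_from [set e : R | 0 < e] (fun e => [set w | dist v w < e]).
Proof.
apply/seteqP; split=> [U /nbhs_seminorm[k [e e0 eU]]|U [d /= d0 dU]].
  have [d d0 dP] := truncated_sup_lt_seminorm_ball D order p k e0.
  by exists d => // w /dP/eU.
have [k [e e0 eP]] := seminorm_ball_truncated_sup_lt D order p d0.
by apply/nbhs_seminorm; exists k, e => // w /eP/dU.
Qed.

Let dist_complete (u : nat -> E) :
  (forall e : R, 0 < e -> exists N, forall l m, (N <= l)%N -> (N <= m)%N ->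
     dist (u l) (u m) < e) ->
  exists v : E, u @ \oo --> v.
Proof.
move=> uC; apply: seminorm_complete => k e e0.
have [d d0 dP] := truncated_sup_lt_seminorm_ball D order p k e0.
by have [N uN] := uC d d0; exists N => l m Nl Nm; exact/dP/uN.
Qed.

Definition seminorm_frechet : frechet R :=
  Frechet distxx dist_eq dist_sym dist_triangle distD2r dist_ball_convex
    nbhs_dist dist_complete.

End SeminormFrechet.

Section BilinearForms.
Context {R : realType} {n : nat}.
Implicit Types (A B : 'M[R]_n) (v w : 'rV[R]_n).

Definition bilin A v w : R := (v *m A *m w^T) 0 0.

Definition posdef A : Prop := forall w, w != 0 -> 0 < bilin A w w.

Lemma bilinE A v w : bilin A v w = \sum_b (\sum_a v 0 a * A a b) * w 0 b.
Proof. by rewrite /bilin mxE; apply: eq_bigr => b _; rewrite !mxE. Qed.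

Lemma bilin_gram (f : 'rV[R]_n -> 'rV[R]_n -> R) :
  (forall v w, f v w = f w v) -> (forall v, linear (f v : 'rV[R]_n -> R^o)) ->
  forall v w,
    f v w = bilin (\matrix_(a, b) f (delta_mx 0 a) (delta_mx 0 b)) v w.
Proof.
move=> f_sym f_lin v w.
have f_sumr u u' : f u u' = \sum_b f u (delta_mx 0 b) * u' 0 b.
  pose fu : {linear 'rV[R]_n -> R^o} := HB.pack (f u : 'rV[R]_n -> R^o)
    (GRing.isLinear.Build _ _ _ _ (f u : 'rV[R]_n -> R^o) (f_lin u)).
  rewrite -[LHS]/(fu u') {1}(row_sum_delta u') linear_sum.
  by apply: eq_bigr => b _; rewrite linearZ mulrC.
rewrite bilinE f_sumr; apply: eq_bigr => b _; congr (_ * _).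
rewrite f_sym f_sumr; apply: eq_bigr => a _.
by rewrite mxE f_sym mulrC.
Qed.

Lemma bilinZZ A c v w : bilin A (c *: v) (c *: w) = c ^+ 2 * bilin A v w.
Proof. by rewrite /bilin linearZ/= -!(scalemxAl, scalemxAr) scalerA !mxE. Qed.

Lemma bilinB A B v w : bilin (A - B) v w = bilin A v w - bilin B v w.
Proof. by rewrite /bilin mulmxBr mulmxBl !mxE. Qed.

Lemma bilin_linear A v : linear (bilin A v : 'rV[R]_n -> R^o).
Proof. by move=> a w w'; rewrite /bilin linearP mulmxDr -scalemxAr !mxE. Qed.

Lemma bilin_le A v w : `|bilin A v w| <= (`|v| * `|A| * `|w|) *+ (n * n).
Proof.
rewrite bilinE mulrnA -[X in _ *+ X]card_ord -sumr_const.
apply: le_trans (ler_norm_sum _ _ _) (ler_sum _ _) => b _.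
rewrite mulr_suml -[X in _ *+ X]card_ord -sumr_const.
apply: le_trans (ler_norm_sum _ _ _) (ler_sum _ _) => a _.
by rewrite !normrM ?ler_pM ?mulr_ge0 ?le_mx_norm.
Qed.

Lemma cvg_bilin {T : Type} {F : set_system T} {FF : Filter F} (f : T -> 'M[R]_n)
    (g h : T -> 'rV[R]_n) A v w : f @ F --> A -> g @ F --> v -> h @ F --> w ->
  bilin (f t) (g t) (h t) @[t --> F] --> bilin A v w.
Proof.
move=> fA gv hw.
have cvg_entry p q (u : T -> 'M[R]_(p, q)) (l : 'M[R]_(p, q)) a b :
    u @ F --> l -> u t a b @[t --> F] --> l a b.
  by move=> ul; exact: cvg_comp ul (@coord_continuous _ _ _ a b l).
rewrite bilinE; under eq_cvg do rewrite bilinE.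
apply: (@cvg_big R^o _ +%R 0 xpredT); first exact: add_continuous.
move=> b _; apply: cvgM; last exact: cvg_entry.
apply: (@cvg_big R^o _ +%R 0 xpredT); first exact: add_continuous.
by move=> a _; apply: cvgM; exact: cvg_entry.
Qed.

Lemma posdef_unit A : (forall w, `|w| = 1 -> 0 < bilin A w w) -> posdef A.
Proof.
move=> A1 w w0; have nw0 : 0 < `|w| by rewrite normr_gt0.
have -> : w = `|w| *: (`|w|^-1 *: w) by rewrite scalerA divff ?scale1r// gt_eqF.
rewrite bilinZZ mulr_gt0 ?exprn_gt0// A1//.
by rewrite normrZ ger0_norm ?invr_ge0// mulVf// gt_eqF.
Qed.

Lemma compact_sphere : compact [set w : 'rV[R]_n | `|w| = 1].
Proof.
apply: bounded_closed_compact.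
  by exists 1; split=> [|A A1 w /= ->]; [exact: num_real|exact: ltW].
apply: (@preimage_closed _ _ (fun w : 'rV[R]_n => `|w|) [set 1]).
  by move=> w _; exact: norm_continuous.
exact: closed_eq.
Qed.

Lemma compact_posdef_ge {X : topologicalType} (f : X -> 'M[R]_n) (K : set X) :
  compact K -> (forall x, K x -> {for x, continuous f}) ->
  (forall x, K x -> posdef (f x)) ->
  exists2 d, 0 < d & forall x w, K x -> `|w| = 1 -> d <= bilin (f x) w w.
Proof.
move=> cK cf fpos; pose C := K `*` [set w : 'rV[R]_n | `|w| = 1].
have [C0|C0] := pselect (C !=set0); last first.
  by exists 1 => // x w Kx w1; case: C0; exists (x, w).
have cC : compact C by apply: compact_setX; [exact: cK|exact: compact_sphere].
have cq : {within C,
    continuous (fun z : X * 'rV[R]_n => bilin (f z.1) z.2 z.2)}.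
  apply: continuous_in_subspaceT => z; rewrite inE => -[/= Kz _].
  apply: cvg_bilin; [|exact: cvg_snd..].
  by apply: (@continuous_comp _ _ _ fst f); [exact: cvg_fst|exact: cf].
have [z] := compact_EVT_min C0 cC cq; rewrite inE => -[/= Kz z1] zmin.
exists (bilin (f z.1) z.2 z.2); last first.
  by move=> x w Kx w1; apply: (zmin (x, w)); rewrite inE.
by apply: fpos => //; rewrite -normr_eq0 z1 oner_eq0.
Qed.

Lemma compact_posdef_stable {X : topologicalType} (f : X -> 'M[R]_n)
    (K : set X) :
  compact K -> (forall x, K x -> {for x, continuous f}) ->
  (forall x, K x -> posdef (f x)) ->
  exists2 e, 0 < e & forall x B, K x -> `|f x - B| < e -> posdef B.
Proof.
move=> cK cf fpos; have [d d0 fd] := compact_posdef_ge cK cf fpos.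
exists (d / (n * n).+1%:R) => [|x B Kx fB]; first by rewrite divr_gt0.
apply: posdef_unit => w w1; have := fd x w Kx w1.
have := bilin_le (f x - B) w w.
rewrite w1 mulr1 mul1r bilinB ler_norml => /andP[_].
have : `|f x - B| *+ (n * n) < d.
  rewrite ltr_pdivlMr// mulr_natr mulrS in fB.
  by rewrite (le_lt_trans _ fB)// lerDr.
by move: (bilin _ _ _) (bilin _ _ _) => b c; lra.
Qed.

End BilinearForms.

Section Components.
Context {R : realType} {n : nat} (M : smooth_manifold R n).
Implicit Types (i j : midx M) (h g : sym2_section M) (s t : seq 'I_n) (p : M).

Definition chart_image i : set 'rV[R]_n := cmap (mchart i) @` cdom (mchart i).

Lemma open_chart_image i : open (chart_image i).
Proof. exact: cimage_open. Qed.

Lemma exists_chart p : exists i, cdom (mchart i) p.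
Proof.
have [i _ ip] : (\bigcup_i cdom (mchart i)) p by rewrite (mchart_cover M).
by exists i.
Qed.

Lemma open_overlap j i : open (overlap (mchart j) (mchart i)).
Proof.
rewrite openE => _ [p [jp ip] <-].
have := near_overlap jp ip; apply: filterS => x [ix [q jq qx]].
by move: ix; rewrite -qx cmapK ?inE// => iq; exists q.
Qed.

Lemma transition_chart_image j i x : overlap (mchart j) (mchart i) x ->
  chart_image i (transition (mchart j) (mchart i) x).
Proof.
by move=> [p [jp ip] <-]; exists p => //; rewrite /transition/= cmapK ?inE.
Qed.

Lemma coord_vec_linear i p : linear (coord_vec i p).
Proof.
move=> a w w'; apply/val_inj/funext => j.
rewrite -[RHS]/(a *: coord_fun i p w j + coord_fun i p w' j) /= /coord_fun.
case: ifP => _; first by rewrite mulmxDl -scalemxAl.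
by rewrite scaler0 addr0.
Qed.

Lemma coord_vec_change j i p w : cdom (mchart j) p -> cdom (mchart i) p ->
  coord_vec j p w i = w *m chart_jac j i p.
Proof. by move=> jp ip; rewrite /= /coord_fun asboolT. Qed.

Lemma coord_vecK i p (v : tangent p) : cdom (mchart i) p ->
  coord_vec i p (v i) = v.
Proof.
move=> ip; have /asboolP[v0 vJ] := tcoordP v.
apply/val_inj/funext => k; have [kp|kp] := pselect (cdom (mchart k) p).
  by rewrite -[LHS]/(coord_vec i p (v i) k) coord_vec_change//; exact/esym/vJ.
by rewrite /= /coord_fun asboolF ?v0// => -[].
Qed.

Definition components i h : 'rV[R]_n -> 'M[R]_n :=
  form_components (@Defs.form _ _ _ h) i.

Definition section_jet i s h : 'rV[R]_n -> 'M[R]_n :=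
  iter_partial s (components i h).

Lemma smooth_components i h : smooth_on (chart_image i) (components i h).
Proof. exact: form_smooth. Qed.

Lemma smooth_section_jet i s h : smooth_on (chart_image i) (section_jet i s h).
Proof. exact/smooth_iter_partial/smooth_components. Qed.

Lemma form_components_at h i p (v w : tangent p) : cdom (mchart i) p ->
  Defs.form h v w = bilin (components i h (cmap (mchart i) p)) (v i) (w i).
Proof.
move=> ip; rewrite -[v in LHS](coord_vecK v ip) -[w in LHS](coord_vecK w ip).
pose f (x y : 'rV[R]_n) := Defs.form h (coord_vec i p x) (coord_vec i p y).
rewrite -[LHS]/(f (v i) (w i)) bilin_gram.
- congr bilin; apply/matrixP => a b; rewrite !mxE /f.
  by rewrite cmapK ?inE.
- by move=> x y; exact: form_sym.
- by move=> x a y z; rewrite /f coord_vec_linear form_linear.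
Qed.

Lemma components_change j i h x : overlap (mchart j) (mchart i) x ->
  components j h x =
  pullback (transition (mchart j) (mchart i)) (components i h) x.
Proof.
move=> [p [jp ip] <-]; apply/matrixP => k l.
rewrite [LHS]mxE cmapK ?inE//= (form_components_at _ _ _ ip).
rewrite !coord_vec_change// /bilin /pullback /transition/= cmapK ?inE//.
by rewrite trmx_mul trmx_delta !mulmxA -rowE -!row_mul -colE !mxE.
Qed.

Lemma riemannian_at_posdef h i p : cdom (mchart i) p ->
  (forall v : tangent p, v != 0 -> 0 < Defs.form h v v) <->
  posdef (components i h (cmap (mchart i) p)).
Proof.
move=> ip; split=> [hpos w w0|hpos v v0].
  have := hpos (coord_vec i p w).
  rewrite (form_components_at _ _ _ ip) coord_vecE//; apply.
  by apply: contra_neq w0 => cw0; rewrite -(coord_vecE w ip) cw0.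
rewrite (form_components_at _ _ _ ip); apply: hpos; apply: contra_neq v0 => vi0.
rewrite -(coord_vecK v ip) vi0.
by have := coord_vec_linear i p (-1) 0 0; rewrite scaler0 addr0 scaleN1r addNr.
Qed.

Lemma section_jet_bound j i s x0 : overlap (mchart j) (mchart i) x0 ->
  exists C : R, \forall x \near x0, forall h e,
    jet_le (size s) e (components i h) (transition (mchart j) (mchart i) x) ->
    `|section_jet j s h x| <= C * e.
Proof.
move=> Ox0; have oO := @open_overlap j i.
have [C Cx] := iter_partial_pullback_bound oO (@mchart_smooth _ _ M j i)
  (@transition_chart_image j i) s Ox0.
exists C; apply: filterS2 Cx (open_nbhs_nbhs (conj oO Ox0)) => x Cx Ox h e he.
rewrite /section_jet (eq_iter_partial oO _ (@components_change j i h))//.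
by apply: Cx he; exact: smooth_components.
Qed.

End Components.

Section SectionModule.
Context {R : realType} {n : nat} (M : smooth_manifold R n).
Local Notation S := (sym2_section M).
Implicit Types (i : midx M) (h g : S) (s : seq 'I_n).

Lemma sym2_section_eq h g :
  (forall p (v w : tangent p), Defs.form h v w = Defs.form g v w) -> h = g.
Proof.
case: h g => [h hs hl hd] [g gs gl gd] /= hg.
have {}hg : h = g.
  by do 3 (apply: functional_extensionality_dep => ?); exact: hg.
rewrite hg in hs hl hd *; congr Sym2Section; exact: Prop_irrelevance.
Qed.

Section LinearCombination.
Variables (a : R) (h g : S).

Let f : form_field M := fun p v w => a * Defs.form h v w + Defs.form g v w.

Let f_sym p (v w : tangent p) : f v w = f w v.
Proof. by rewrite /f !(form_sym _ v). Qed.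

Let f_linear p (v : tangent p) : linear (f v : tangent p -> R^o).
Proof.
by move=> b x y; rewrite /f !form_linear -![_ *: _]/(_ * _); ring.
Qed.

Let f_smooth i : smooth_on (chart_image i) (form_components f i).
Proof.
apply: eq_smooth
  (smooth_lincomb _ a (smooth_components i h) (smooth_components i g)).
- exact: open_chart_image.
- by move=> x _; apply/matrixP => k l; rewrite !mxE.
- exact: open_chart_image.
Qed.

Definition sym2_lincomb := Sym2Section f_sym f_linear f_smooth.

End LinearCombination.

Let f0 : form_field M := fun p v w => 0.

Let f0_sym p (v w : tangent p) : f0 v w = f0 w v. Proof. by []. Qed.

Let f0_linear p (v : tangent p) : linear (f0 v : tangent p -> R^o).
Proof. by move=> b x y; rewrite /f0 scaler0 addr0. Qed.

Let f0_smooth i : smooth_on (chart_image i) (form_components f0 i).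
Proof.
apply: eq_smooth (smooth0 _); try exact: open_chart_image.
by move=> x _; apply/matrixP => k l; rewrite !mxE.
Qed.

Definition sym2_zero : S := Sym2Section f0_sym f0_linear f0_smooth.

Let add h g := sym2_lincomb 1 h g.
Let opp h := sym2_lincomb (-1) h sym2_zero.
Let scale a h := sym2_lincomb a h sym2_zero.

Let addA : associative add.
Proof. by move=> h g u; apply: sym2_section_eq => p v w /=; ring. Qed.
Let addC : commutative add.
Proof. by move=> h g; apply: sym2_section_eq => p v w /=; ring. Qed.
Let add0 : left_id sym2_zero add.
Proof. by move=> h; apply: sym2_section_eq => p v w /=; rewrite /f0; ring. Qed.
Let addN : left_inverse sym2_zero opp add.
Proof. by move=> h; apply: sym2_section_eq => p v w /=; rewrite /f0; ring. Qed.

HB.instance Definition _ := GRing.isZmodule.Build S addA addC add0 addN.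

Let scaleA a b h : scale a (scale b h) = scale (a * b) h.
Proof. by apply: sym2_section_eq => p v w /=; rewrite /f0; ring. Qed.
Let scale1 : left_id 1 scale.
Proof. by move=> h; apply: sym2_section_eq => p v w /=; rewrite /f0; ring. Qed.
Let scaleDr : right_distributive scale +%R.
Proof.
by move=> a h g; apply: sym2_section_eq => p v w /=; rewrite /f0; ring.
Qed.
Let scaleDl h : {morph scale^~ h : a b / a + b}.
Proof.
by move=> a b; apply: sym2_section_eq => p v w /=; rewrite /f0; ring.
Qed.

HB.instance Definition _ := GRing.Zmodule_isLmodule.Build R S
  scaleA scale1 scaleDr scaleDl.

Lemma components_lincomb i a h g :
  components i (a *: h + g) = a *: components i h + components i g.
Proof.
apply/funext => x; apply/matrixP => k l; rewrite !mxE/=.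
by rewrite /f0; ring.
Qed.

Lemma section_jet_lincomb i s a h g x : chart_image i x ->
  section_jet i s (a *: h + g) x =
  a *: section_jet i s h x + section_jet i s g x.
Proof.
move=> ix; rewrite /section_jet components_lincomb.
apply: iter_partial_lincomb ix; first exact: open_chart_image.
- exact: smooth_components.
- exact: smooth_components.
Qed.

Lemma section_jetZ i s a h x : chart_image i x ->
  section_jet i s (a *: h) x = a *: section_jet i s h x.
Proof.
move=> ix; have jet0 : section_jet i s (0 : S) x = 0.
  have := section_jet_lincomb s (-1) 0 0 ix.
  by rewrite scaler0 addr0 scaleN1r addNr.
by rewrite -[a *: h]addr0 section_jet_lincomb// jet0 addr0.
Qed.

Lemma section_jetD i s h g x : chart_image i x ->
  section_jet i s (h + g) x = section_jet i s h x + section_jet i s g x.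
Proof. by move=> ix; rewrite -[h]scale1r section_jet_lincomb// !scale1r. Qed.

Lemma section_jetB i s h g x : chart_image i x ->
  section_jet i s (h - g) x = section_jet i s h x - section_jet i s g x.
Proof.
by move=> ix; rewrite section_jetD// -scaleN1r section_jetZ// scaleN1r.
Qed.

End SectionModule.

Lemma norm_scaleB_lt {R : realFieldType} {W : normedModType R} (a b C e : R)
    (x y : W) : 0 < C -> `|x| <= C -> `|a - b| < Num.min 1 (e / 2 / C) ->
  `|x - y| < e / 2 / (`|a| + 1) -> `|a *: x - b *: y| < e.
Proof.
move=> C0 xC; rewrite lt_min => /andP[ab1 abC] xy.
have -> : a *: x - b *: y = (a - b) *: x + b *: (x - y).
  by rewrite scalerBr scalerBl addrA subrK.
rewrite [ltRHS]splitr (le_lt_trans (ler_normD _ _))// !normrZ ltrD//.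
  apply: (@le_lt_trans _ _ (`|a - b| * C)); first by rewrite ler_wpM2l.
  by rewrite -ltr_pdivlMr.
apply: (@le_lt_trans _ _ ((`|a| + 1) * `|x - y|)).
  rewrite ler_wpM2r// -[b](subKr a) (le_trans (ler_normB _ _))//.
  by rewrite lerD2l ltW.
by rewrite mulrC -ltr_pdivlMr// ltr_wpDl.
Qed.

Lemma initial_cvgP (S : choiceType) (T : topologicalType) (f : S -> T)
    (F : set_system S) (x : S) : Filter F ->
  F --> (x : initial_topology f) <-> f @ F --> f x.
Proof.
move=> FF; split=> [Fx|fFx].
  by apply: cvg_comp Fx _; exact: initial_continuous.
move=> A [_ [[B oB <-] Bfx] BA]; apply: filterS BA _.
by apply: fFx; exact: open_nbhs_nbhs.
Qed.

Section SectionTopology.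
Context {R : realType} {n : nat} (M : smooth_manifold R n).
Local Notation S := (sym2_section M).
Implicit Types (i : midx M) (h g : S) (s : seq 'I_n).

Lemma cvg_sectionP (F : set_system S) h : Filter F ->
  F --> h <-> forall i s K, chart_compacts i K -> forall e : R, 0 < e ->
    \forall g \near F, unif_close K e (section_jet i s h) (section_jet i s g).
Proof.
move=> FF; apply: (iff_trans (initial_cvgP _ _ _)); split.
  move=> /cvg_sup Fh i s K cK e e0.
  have /initial_cvgP/fam_cvgP/(_ K cK)/= := Fh (i, s).
  move=> /(_ [set f | unif_close K e (section_jet i s h) f]); apply.
  apply/uniform_nbhs; exists [set z : 'M[R]_n * 'M[R]_n | `|z.1 - z.2| < e].
  split=> //; rewrite -entourage_ballE; exists e => // -[A B] /=.
  by rewrite -ball_normE.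
move=> Fh; apply/cvg_sup => -[i s]; apply/initial_cvgP/fam_cvgP => K cK.
move=> A /uniform_nbhs[E []]; rewrite -entourage_ballE => -[e /= e0 eE] EA.
apply: filterS (Fh i s K cK e e0) => g gh; apply: EA => x Kx; apply: eE => /=.
by rewrite -ball_normE; exact: gh.
Qed.

Lemma nbhs_section h i s K e : chart_compacts i K -> 0 < e ->
  \forall g \near h, unif_close K e (section_jet i s h) (section_jet i s g).
Proof. by move=> cK e0; have /cvg_sectionP := @cvg_id _ (nbhs h); apply. Qed.

Lemma section_jet_bounded i s h K : chart_compacts i K ->
  exists2 C : R, 0 < C & forall x, K x -> `|section_jet i s h x| <= C.
Proof.
move=> [cK Ki]; have cjet : {within K, continuous (section_jet i s h)}.
  apply: continuous_in_subspaceT => x; rewrite inE => /Ki.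
  exact/smooth_continuous/smooth_section_jet.
have /compact_bounded bjet := continuous_compact cjet cK.
near (pinfty_nbhs R) => C.
exists C => [|x Kx]; first by near: C; exact: nbhs_pinfty_gt.
have Cjet : forall y, (section_jet i s h @` K) y -> `|y| <= C.
  by near: C; exact: bjet.
by apply: Cjet; exists x.
Unshelve. all: by end_near. Qed.

Let sym2_add_continuous : continuous (fun z : S * S => z.1 + z.2).
Proof.
move=> [h g]; apply/cvg_sectionP => i s K cK e e0 /=.
have e20 : 0 < e / 2 by rewrite divr_gt0.
pose close h :=
  [set h' | unif_close K (e / 2) (section_jet i s h) (section_jet i s h')].
exists (close h, close g) => /=; first by split; exact: nbhs_section.
move=> [h' g'] /= [hh' gg'] x Kx; rewrite !section_jetD; [|exact: cK.2..].
rewrite opprD addrACA [ltRHS]splitr (le_lt_trans (ler_normD _ _))// ltrD//.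
  exact: hh'.
exact: gg'.
Qed.

Let sym2_scale_continuous : continuous (fun z : R^o * S => z.1 *: z.2).
Proof.
move=> [a h]; apply/cvg_sectionP => i s K cK e e0 /=.
have [C C0 hC] := section_jet_bounded s h cK.
exists ([set b : R^o | `|a - b| < Num.min 1 (e / 2 / C)],
  [set g | unif_close K (e / 2 / (`|a| + 1)) (section_jet i s h)
    (section_jet i s g)]) => /=.
  split; last by apply: nbhs_section => //; rewrite !divr_gt0// ltr_wpDl.
  apply/nbhs_ballP; exists (Num.min 1 (e / 2 / C)); last by rewrite -ball_normE.
  by rewrite /= lt_min ltr01 !divr_gt0.
move=> [b g] /= [ab hg] x Kx; rewrite !section_jetZ; [|exact: cK.2..].
exact: norm_scaleB_lt C0 (hC x Kx) ab (hg x Kx).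
Qed.

HB.instance Definition _ :=
  PreTopologicalNmodule_isTopologicalNmodule.Build S sym2_add_continuous.
HB.instance Definition _ :=
  TopologicalNmodule_isTopologicalLmodule.Build R S sym2_scale_continuous.

End SectionTopology.

Section SectionLimit.
Context {R : realType} {n : nat} (M : smooth_manifold R n).
Variable u : nat -> sym2_section M.
Hypothesis u_cauchy :
  forall i, cauchy_partials (chart_image i) (fun k => components i (u k)).
Implicit Types (i : midx M) (p : M).

Definition limit_components i : 'rV[R]_n -> 'M[R]_n :=
  limit_partial (fun k => components i (u k)) [::].

Definition limit_form : form_field M :=
  fun p v w => lim (Defs.form (u k) v w @[k --> \oo]).

Lemma limit_form_components_at i p (v w : tangent p) : cdom (mchart i) p ->
  limit_form v w = bilin (limit_components i (cmap (mchart i) p)) (v i) (w i).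
Proof.
move=> ip; apply: cvg_lim => //.
under eq_cvg do rewrite (form_components_at _ _ _ ip).
apply: cvg_bilin; [|exact: cvg_cst..].
by apply: (limit_partial_cvg (@u_cauchy i)); exists p.
Qed.

Lemma limit_form_sym p (v w : tangent p) : limit_form v w = limit_form w v.
Proof. by rewrite /limit_form; under eq_fun do rewrite form_sym. Qed.

Lemma limit_form_linear p (v : tangent p) :
  linear (limit_form v : tangent p -> R^o).
Proof.
move=> a w w'; have [i ip] := exists_chart p.
by rewrite !(limit_form_components_at _ _ ip); exact: bilin_linear.
Qed.

Lemma form_components_limit i x : chart_image i x ->
  form_components limit_form i x = limit_components i x.
Proof.
move=> [p ip <-]; apply/matrixP => k l; rewrite mxE cmapK ?inE//=.
rewrite (limit_form_components_at _ _ ip) !coord_vecE// /bilin.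
by rewrite trmx_delta -rowE -colE !mxE.
Qed.

Lemma limit_form_smooth i :
  smooth_on (chart_image i) (form_components limit_form i).
Proof.
apply: eq_smooth (smooth_limit_partial _ _ (@u_cauchy i) [::]).
- exact: open_chart_image.
- by move=> x ix; rewrite form_components_limit.
- exact: open_chart_image.
- by move=> k; exact: smooth_components.
Qed.

Definition limit_section : sym2_section M :=
  Sym2Section limit_form_sym limit_form_linear limit_form_smooth.

Lemma cvg_limit_section : u @ \oo --> limit_section.
Proof.
apply/cvg_sectionP => i s K [cK Ki] e e0.
have oi := @open_chart_image _ _ M i.
have ui k := smooth_components i (u k).
have unifK := limit_partial_unif (@u_cauchy i) s cK Ki e0.
apply: filterS unifK => k uk x Kx; have ix := Ki _ Kx.
rewrite [section_jet i s limit_section x](eq_iter_partial oi s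
  (@form_components_limit i) ix).
by rewrite (iter_partial_limit oi ui (@u_cauchy i) s ix); exact: uk.
Qed.

End SectionLimit.

Lemma compact_nbhs_cover {T : topologicalType} (A : set T) (U : T -> set T) :
  compact A -> (forall x, A x -> nbhs x (U x)) ->
  exists s : seq T, forall y, A y -> exists2 x, x \in s & U x y.
Proof.
move=> cA nU.
pose F : set_system (seq T) :=
  filter_from [set: seq T] (fun s => [set s' : seq T | {subset s <= s'}]).
have FF : Filter F.
  apply: filter_from_filter; first by exists [::].
  move=> s s' _ _; exists (s ++ s') => // s'' /= ss''.
  by split=> x xs; apply: ss''; rewrite mem_cat xs ?orbT.
have [x Ax|s _ sA] := (compact_near_coveringP A).1 cA _ F
    (fun s y => exists2 x, x \in s & U x y) FF; last by exists s; exact: sA.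
exists (U x, [set s : seq T | {subset [:: x] <= s}]) => /=.
  by split; [exact: nU|exists [:: x]].
by move=> [y s] /= [Uy xs]; exists x => //; apply: xs; rewrite mem_head.
Qed.

Record finite_chart_cover {R : realType} {n : nat} (M : smooth_manifold R n) :=
  FiniteChartCover {
  cover_idx : finType;
  cover_chart : cover_idx -> midx M;
  cover_compact : cover_idx -> set 'rV[R]_n;
  cover_chart_compacts :
    forall c, chart_compacts (cover_chart c) (cover_compact c);
  cover_nbhs : forall p : M, exists2 c, cdom (mchart (cover_chart c)) p &
    nbhs (cmap (mchart (cover_chart c)) p) (cover_compact c)
}.

Lemma compact_finite_chart_cover {R : realType} {n : nat}
    (M : smooth_manifold R n) :
  compact [set: M] -> inhabited (finite_chart_cover M).
Proof.
move=> cM.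
have /choice[i ip] (p : M) := exists_chart p.
have /choice[K KP] (p : M) : exists K, chart_compacts (i p) K /\
    nbhs (cmap (mchart (i p)) p) K.
  have [|K [cK Ki nK]] := compact_nbhs_in_open (@open_chart_image _ _ M (i p))
    (x := cmap (mchart (i p)) p); first by exists p.
  by exists K.
have [p _|s sM] := compact_nbhs_cover (U := fun p => cdom (mchart (i p)) `&`
    cmap (mchart (i p)) @^-1` (K p)^°) cM.
  apply: filterI; first exact: open_nbhs_nbhs (conj (cdom_open _) (ip p)).
  have := @cmap_continuous _ _ (mchart (i p)).
  rewrite continuous_open_subspace; last exact: cdom_open.
  move=> /(_ p); rewrite inE => /(_ (ip p)); apply.
  exact/nbhs_interior/(KP p).2.
split; apply: (@FiniteChartCover _ _ _ (seq_sub s) (i \o val) (K \o val)).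
  by move=> c; exact: (KP _).1.
move=> q; have [p ps [iq Kq]] := sM q I.
by exists (SeqSub ps).
Qed.

Section SectionFrechet.
Context {R : realType} {n : nat} (M : smooth_manifold R n).
Variable L : finite_chart_cover M.
Local Notation S := (sym2_section M).
Local Notation jet_point := (cover_idx L * seq 'I_n * 'rV[R]_n)%type.
Implicit Types (h g : S) (s : seq 'I_n) (c : cover_idx L) (z : jet_point).

Definition cover_points : set jet_point := [set z | cover_compact z.1.1 z.2].

Definition jet_order z : nat := size z.1.2.

Definition jet_norm z h : R := `|section_jet (cover_chart z.1.1) z.1.2 h z.2|.

Local Notation jet_ball := (seminorm_ball cover_points jet_order jet_norm).

Let cover_points_chart z :
  cover_points z -> chart_image (cover_chart z.1.1) z.2.
Proof. exact: (cover_chart_compacts z.1.1).2. Qed.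

Lemma jet_normZ z a h :
  cover_points z -> jet_norm z (a *: h) = `|a| * jet_norm z h.
Proof.
by move=> /cover_points_chart zi; rewrite /jet_norm section_jetZ// normrZ.
Qed.

Lemma jet_normD z h g :
  cover_points z -> jet_norm z (h + g) <= jet_norm z h + jet_norm z g.
Proof.
by move=> /cover_points_chart zi; rewrite /jet_norm section_jetD// ler_normD.
Qed.

Lemma jet_norm_separating h :
  (forall z, cover_points z -> jet_norm z h = 0) -> h = 0.
Proof.
move=> h0; apply: sym2_section_eq => p v w.
have [c cp /nbhs_singleton Kp] := cover_nbhs L p.
pose x := cmap (mchart (cover_chart c)) p.
have components0 : components (cover_chart c) h x = 0.
  exact/normr0_eq0/(h0 (c, [::], x)).
rewrite (form_components_at _ _ _ cp) -/x components0 /bilin.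
by rewrite mulmx0 mul0mx mxE.
Qed.

Lemma section_jet_le_jet_ball j s x0 : chart_image j x0 ->
  exists C : R, \forall x \near x0, forall d h, jet_ball (size s) d h ->
    `|section_jet j s h x| <= C * d.
Proof.
move=> [p jp px]; have [c cp nK] := cover_nbhs L p.
have Ox0 : overlap (mchart j) (mchart (cover_chart c)) x0 by exists p.
have [C jetC] := section_jet_bound s Ox0.
pose phi := transition (mchart j) (mchart (cover_chart c)).
have nphi : \forall x \near x0, cover_compact c (phi x).
  have : {for x0, continuous phi}.
    exact: smooth_continuous (@mchart_smooth _ _ M j _) Ox0.
  by apply; rewrite /phi -px /transition/= cmapK ?inE.
exists C; apply: filterS2 nphi jetC => x Kx jetC d h hd.
by apply: jetC => t ts; exact/ltW/(hd (c, t, phi x)).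
Qed.

Lemma section_jet_lt_jet_ball j s K e : chart_compacts j K -> 0 < e ->
  exists2 d : R, 0 < d & forall h, jet_ball (size s) d h ->
    forall x, K x -> `|section_jet j s h x| < e.
Proof.
move=> [cK Kj] e0; pose small d x :=
  forall h, jet_ball (size s) d h -> `|section_jet j s h x| < e.
have nsmall : \forall d \near 0^'+, K `<=` small d.
  apply: (compact_near_coveringP K).1 => // x0 /Kj jx0.
  have [C jetC] := section_jet_le_jet_ball s jx0.
  have C0 : 0 < `|C| + 1 by rewrite ltr_wpDl.
  exists ([set x | forall d h, jet_ball (size s) d h ->
      `|section_jet j s h x| <= C * d],
    [set d : R | 0 < d /\ d < e / (`|C| + 1)]) => /=.
    split=> //; apply: filterI; first exact: nbhs_right_gt.
    by apply: nbhs_right_lt; rewrite divr_gt0.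
  move=> [x d] /= [{}jetC [d0 de]] h /jetC hx; apply: le_lt_trans hx _.
  apply: (@le_lt_trans _ _ ((`|C| + 1) * d)).
    by rewrite ler_wpM2r ?(ltW d0)// (le_trans (ler_norm _))// lerDl.
  by rewrite mulrC -ltr_pdivlMr.
near (0 : R)^'+ => d.
exists d => [|h hd x Kx]; first by near: d; exact: nbhs_right_gt.
have Kd : K `<=` small d by near: d.
exact: Kd Kx h hd.
Unshelve. all: by end_near. Qed.

Lemma nbhs_jet_ball h k e : 0 < e -> \forall g \near h, jet_ball k e (h - g).
Proof.
move=> e0; pose near_jet (cs : cover_idx L * k.-bseq 'I_n) :=
  [set g | unif_close (cover_compact cs.1) e
    (section_jet (cover_chart cs.1) cs.2 h)
    (section_jet (cover_chart cs.1) cs.2 g)].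
have : \forall g \near h, forall cs, near_jet cs g.
  apply: (@filter_forall _ _ near_jet _ (nbhs_filter h)) => cs.
  exact: nbhs_section (cover_chart_compacts cs.1) e0.
apply: filterS => g hg [[c s] x] /= cx sk; rewrite /jet_norm section_jetB/=.
  exact: (hg (c, Bseq sk) x cx).
exact: (cover_chart_compacts c).2.
Qed.

Lemma nbhs_section_jet_ball h (U : set S) : nbhs h U <->
  exists k, exists2 e, 0 < e & forall g, jet_ball k e (h - g) -> U g.
Proof.
split=> [|[k [e e0 eU]]]; last by apply: filterS eU _; exact: nbhs_jet_ball.
pose F := filter_from [set ke : nat * R | 0 < ke.2]
  (fun ke => [set g | jet_ball ke.1 ke.2 (h - g)]).
have FF : Filter F.
  apply: filter_from_filter; first by exists (0%N, 1) => /=.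
  move=> [k d] [l e] /= d0 e0.
  exists (maxn k l, Num.min d e); first by rewrite /= lt_min d0.
  move=> g /= hg; split=> z zL zk; have := hg z zL.
    by rewrite leq_max zk lt_min => /(_ isT)/andP[].
  by rewrite leq_max zk orbT lt_min => /(_ isT)/andP[].
suff /[apply] -[[k e] /= e0 eU] : F --> h by exists k, e.
apply/cvg_sectionP => i s K cK e e0.
have [d d0 hd] := section_jet_lt_jet_ball s cK e0.
exists (size s, d) => // g /= gd x Kx.
by rewrite -section_jetB; [exact: hd|exact: cK.2].
Qed.

Lemma section_complete (u : nat -> S) :
  (forall k e, 0 < e -> exists N, forall l m, (N <= l)%N -> (N <= m)%N ->
     jet_ball k e (u l - u m)) ->
  exists h : S, u @ \oo --> h.
Proof.
move=> uC; have u_cauchy i :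
    cauchy_partials (chart_image i) (fun k => components i (u k)).
  move=> s K cK Ki e e0.
  have [d d0 hd] := section_jet_lt_jet_ball s (conj cK Ki) e0.
  have [N uN] := uC (size s) d d0; exists N => k l Nk Nl x Kx.
  by rewrite -section_jetB; [exact: hd (uN _ _ Nk Nl) _ Kx|exact: Ki].
by exists (limit_section u_cauchy); exact: cvg_limit_section.
Qed.

Definition section_frechet : frechet R :=
  seminorm_frechet jet_normZ jet_normD jet_norm_separating nbhs_section_jet_ball
    section_complete.

Lemma open_riemannian_metrics : open (riemannian_metrics M).
Proof.
rewrite openE => g gpos; pose gc c := components (cover_chart c) g.
have /choice[r rP] c : exists r, 0 < r /\ forall x B,
    cover_compact c x -> `|gc c x - B| < r -> posdef B.
  have [cK Ki] := cover_chart_compacts c.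
  have [x Kx|x Kx|r r0 gr] := compact_posdef_stable (f := gc c) cK.
  - exact: smooth_continuous (smooth_components _ _) (Ki _ Kx).
  - by have [p cp <-] := Ki _ Kx; exact: (riemannian_at_posdef g cp).1 (gpos p).
  - by exists r.
pose near_components c := [set h |
  unif_close (cover_compact c) (r c) (gc c) (components (cover_chart c) h)].
have : \forall h \near g, forall c, near_components c h.
  apply: (@filter_forall _ _ near_components _ (nbhs_filter g)) => c.
  exact: (nbhs_section g [::]) (cover_chart_compacts c) (rP c).1.
apply: filterS => h gh p; have [c cp /nbhs_singleton Kp] := cover_nbhs L p.
exact/(riemannian_at_posdef h cp).2/(rP c).2/gh.
Qed.

End SectionFrechet.

Lemma initial_hausdorff {S : choiceType} {T : topologicalType} (f : S -> T) :
  injective f -> hausdorff_space T -> hausdorff_space (initial_topology f).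
Proof.
move=> f_inj hT x y xy; apply/f_inj/hT => B C nB nC.
have cf := @initial_continuous _ _ f.
by have [z []] := xy _ _ (cf x _ nB) (cf y _ nC); exists (f z).
Qed.

Section InclusionChart.
Context {X : topologicalType} (A : set X) (a0 : A) (oA : open A).

Let retract : X -> A := insubd a0.

Let retractK y : A y -> set_val (retract y) = y.
Proof. by move=> Ay; apply: insubdK; rewrite inE. Qed.

Let set_val_image : set_val @` [set: A] = A.
Proof.
apply/seteqP; split=> [_ [x _ <-]|y Ay]; first exact: set_valP.
by exists (retract y) => //; exact: retractK.
Qed.

Let open_set_val_image : open (set_val @` [set: A]).
Proof. by rewrite set_val_image. Qed.

Let set_valK : {in [set: A], cancel set_val retract}.
Proof. by move=> x _; exact: valKd. Qed.

Let set_val_continuous : {within [set: A], continuous (set_val : A -> X)}.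
Proof. exact/continuous_subspaceT/initial_continuous. Qed.

Let retract_continuous : {within set_val @` [set: A], continuous retract}.
Proof.
rewrite set_val_image continuous_open_subspace// => y; rewrite inE => Ay.
apply/initial_cvgP; rewrite retractK// => B nB.
apply: filterS2 nB (open_nbhs_nbhs (conj oA Ay)) => z Bz Az /=.
by rewrite retractK.
Qed.

Definition inclusion_chart : chart A X :=
  Chart openT open_set_val_image set_valK set_val_continuous retract_continuous.

End InclusionChart.

Theorem corollary1p1 (R : realType) (n : nat) (M : smooth_manifold R n)
    (compactM : compact [set: M]) (connectedM : connected [set: M])
    (g0 : riemannian_metrics M) :
  exists A : frechet_atlas R (riemannian_metrics M),
    bounded_frechet_manifold A /\ MC_frechet_manifold None A.
Proof.
have [L] := compact_finite_chart_cover compactM.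
pose E := section_frechet L.
pose c : chart (riemannian_metrics M) E :=
  inclusion_chart g0 (open_riemannian_metrics L).
pose A := @FrechetAtlas R (riemannian_metrics M) unit (fun=> E) (fun=> c).
suff MC_A : MC_frechet_manifold None A by exists A; split=> //; exists None.
split=> //.
- exact: initial_hausdorff val_inj (@frechet_hausdorff R E).
- by apply/seteqP; split=> // x _; exists tt.
- move=> i j k; apply: (@affine_MC _ _ _ _ _ (id_lipHom E) 0).
    by rewrite /overlap setIT; exact: cimage_open.
  by move=> _ [x _ <-]; rewrite addr0 /transition /comp cmapK ?inE.
Qed.
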